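(* The family of finite graphs with VC-dimension $\leq 2$ has the Erdős–Hajnal property; that is, there exists a real number $\epsilon>0$ such that every finite graph $G$ of VC-dimension $\leq 2$ has a clique or an anti-clique of size $\geq |G|^{\epsilon}$.
   Context: A graph $G=(V,E)$ is a vertex set $V$ with a symmetric anti-reflexive binary relation $E$ on $V$; $|G|$ denotes $|V|$. A clique is a set of pairwise adjacent vertices, and an anti-clique is a set of pairwise non-adjacent vertices. For $d\in\mathbb{N}$, a graph $G=(V,E)$ is of VC-dimension $<d$ if there is no $d$-tuple $(x_0,\dots,x_{d-1})$ of pairwise distinct vertices of $V$ such that for every $\epsilon\in\{0,1\}^d$ there is $a_\epsilon\in V$ such that for all $i<d$: $E(a_\epsilon,x_i)$ holds if and only if $\epsilon(i)=1$. VC-dimension $\leq d$ means VC-dimension $<d+1$. A family of finite graphs has the Erdős–Hajnal property if there is $\epsilon>0$ such that every graph $G$ in the family has a clique or an anti-clique of size $\geq |G|^\epsilon$. *)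

(* Defs.v *)
From HB Require Import structures.
From mathcomp Require Import all_boot all_order all_algebra.
From mathcomp Require Import reals exp.

Set Implicit Arguments.
Unset Strict Implicit.
Unset Printing Implicit Defensive.

Import Order.TTheory GRing.Theory Num.Theory.

Record fin_graph := FinGraph {
  vertex :> finType;
  adj : rel vertex;
  adj_sym : symmetric adj;
  adj_irrefl : irreflexive adj }.

Definition clique (G : fin_graph) (A : {set G}) : Prop :=
  {in A &, forall x y, x != y -> adj x y}.

Definition anti_clique (G : fin_graph) (A : {set G}) : Prop :=
  {in A &, forall x y, x != y -> ~~ adj x y}.

(* The witness [a] may be any vertex, possibly one of the [x_i]. *)
Definition vc_dim_lt (d : nat) (G : fin_graph) : Prop :=
  ~ exists x : d.-tuple G, uniq x /\
      forall eps : d.-tuple bool, exists a : G,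
        forall i : 'I_d, adj a (tnth x i) = tnth eps i.

Definition vc_dim_le (d : nat) (G : fin_graph) : Prop := vc_dim_lt d.+1 G.

(* [powR] satisfies [0 `^ eps = 0] for [eps > 0], so the condition is
   satisfied by the graph with no vertices. *)
Definition erdos_hajnal (R : realType) (family : fin_graph -> Prop) : Prop :=
  exists eps : R, (0 < eps)%R /\
    forall G : fin_graph, family G ->
      exists A : {set G}, (clique A \/ anti_clique A) /\
        ((#|G|%:R : R) `^ eps <= #|A|%:R)%R.

(* Main.v *)
(* Write [al X] and [om X] for the sizes of a largest stable set and a largest
   clique in [X].  Excluding a shattered triple (with rows off the columns) is
   preserved by complementation.  A Roedl-type lemma gives a linear-sized subset
   on which the graph or its complement is sparse; choosing sets minimising
   [(al X * om X) ^ s / #|X|] makes this subset critical, so a large [X] cannot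
   contain many pairwise anticomplete pieces of polynomial relative size.

   In a sparse critical set take a vertex [w] of maximum degree and a maximum
   stable set [A] among the vertices with few neighbours in [N(w)].  Criticality
   makes [A] dominate half of [N(w)], from which one extracts a comb: a stable
   [J], disjoint from [N(w)], and equal-sized teeth [T a] in [N(w)] for [a] in
   [J], private to [a], with [#|V|] polynomially bounded in [#|J|] and [#|T a|].
   Given vertices [b], [c] of two other teeth, their traces on [T a] are disjoint,
   nested or cover [T a]: otherwise [a, b, c] is shattered, the rows without
   [a] being [w], the two other centres and a vertex far from everything.  So
   either one can choose one by one many pairwise anticomplete pieces of teeth,
   contradicting criticality, or some piece of a tooth is complete to large parts
   of many teeth, which form a comb again.  The latter cannot happen three times
   unless one of the pieces is a clique: picking a non-adjacent pair in each of
   three pairwise complete pieces would give a shattered triple.  A clique piece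
   bounds [#|T a|], hence [#|V|], by a polynomial in [om] and [al]. *)
Require Import Defs.
From mathcomp Require Import all_boot all_order all_algebra.
From mathcomp Require Import reals exp.
From mathcomp Require Import zify.

Set Implicit Arguments.
Unset Strict Implicit.
Unset Printing Implicit Defensive.

(** * Stable sets *)

Lemma card_setU_leq (T : finType) (A B : {set T}) : #|A :|: B| <= #|A| + #|B|.
Proof. exact: leq_card_setU. Qed.

Lemma card_bigcup_leq (I T : finType) (P : pred I) (F : I -> {set T}) :
  #|\bigcup_(i | P i) F i| <= \sum_(i | P i) #|F i|.
Proof.
elim/big_rec2: _ => [|i m B _ h]; first by rewrite cards0.
by apply: leq_trans (leq_card_setU _ _) _; rewrite leq_add2l.
Qed.

Section Stable.

Variables (V : finType) (e : rel V).

Definition nb (v : V) : {set V} := [set u | e v u].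

Definition stab (A : {set V}) : bool := [forall x in A, forall y in A, ~~ e x y].

Definition alpha (X : {set V}) : nat :=
  \max_(A : {set V} | (A \subset X) && stab A) #|A|.

Definition sep (A B : {set V}) : bool :=
  [disjoint A & B] && [forall x in A, forall y in B, ~~ e x y].

Definition complete (A B : {set V}) : Prop := {in A & B, forall x y, e x y}.

Lemma stabP (A : {set V}) : reflect {in A &, forall x y, ~~ e x y} (stab A).
Proof.
apply: (iffP forall_inP) => [h x y xA yA|h x xA].
  by move/forall_inP: (h x xA); apply.
by apply/forall_inP => y yA; apply: h.
Qed.

Lemma sepP (A B : {set V}) :
  reflect ([disjoint A & B] /\ {in A & B, forall x y, ~~ e x y}) (sep A B).
Proof.
apply: (iffP andP) => -[h1 h2]; split=> //.
  by move=> x y xA yB; move/forall_inP: h2 => /(_ x xA)/forall_inP; apply.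
by apply/forall_inP => x xA; apply/forall_inP => y yB; apply: h2.
Qed.

Lemma leq_alpha (X A : {set V}) : A \subset X -> stab A -> #|A| <= alpha X.
Proof. by move=> AX sA; apply: (@leq_bigmax_cond _ _ (fun A : {set V} => #|A|)); rewrite AX. Qed.

Lemma stab0 : stab set0.
Proof. by apply/stabP => x y; rewrite inE. Qed.

Lemma alphaP (X : {set V}) :
  exists A : {set V}, [/\ A \subset X, stab A & #|A| = alpha X].
Proof.
have P0 : (set0 \subset X) && stab set0 by rewrite sub0set stab0.
rewrite /alpha (bigmax_eq_arg set0) //.
by case: arg_maxnP => // A /andP[AX sA] _; exists A.
Qed.

Lemma alphaS (X Y : {set V}) : X \subset Y -> alpha X <= alpha Y.
Proof.
move=> XY; have [A [AX sA <-]] := alphaP X.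
by apply: leq_alpha => //; apply: subset_trans XY.
Qed.

Lemma alpha_le_card (X : {set V}) : alpha X <= #|X|.
Proof. by have [A [AX _ <-]] := alphaP X; apply: subset_leq_card. Qed.

Lemma alpha_gt0 (X : {set V}) : irreflexive e -> X != set0 -> 0 < alpha X.
Proof.
move=> irr /set0Pn[x xX]; rewrite -(cards1 x); apply: leq_alpha; first by rewrite sub1set.
by apply/stabP => y z /set1P-> /set1P->; rewrite irr.
Qed.

Hypothesis sym : symmetric e.

Lemma stabU (A B : {set V}) :
  stab A -> stab B -> {in A & B, forall x y, ~~ e x y} -> stab (A :|: B).
Proof.
move=> /stabP sA /stabP sB h; apply/stabP => x y /setUP[xA|xB] /setUP[yA|yB].
- exact: sA.
- exact: h.
- by rewrite sym; apply: h.
- exact: sB.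
Qed.

Lemma alpha_sep (X A B : {set V}) :
  A \subset X -> B \subset X -> sep A B -> alpha A + alpha B <= alpha X.
Proof.
move=> AX BX /sepP[dAB nAB].
have [A' [A'A sA <-]] := alphaP A; have [B' [B'B sB <-]] := alphaP B.
have -> : #|A'| + #|B'| = #|A' :|: B'|.
  have/disjoint_setI0 : [disjoint A' & B'].
    by apply: disjointWl A'A _; apply: disjointWr B'B _.
  by rewrite cardsU => ->; rewrite cards0 subn0.
apply: leq_alpha; first by rewrite subUset (subset_trans A'A) ?(subset_trans B'B).
apply: stabU => // x y xA yB; apply: nAB; first exact: (subsetP A'A).
exact: (subsetP B'B).
Qed.

(** Largest stable sets of pairwise anticomplete blocks unite to a stable set. Criticality is
    contradicted through this bound, since many blocks force one of them to have a small [alpha]. *)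
Lemma alpha_blocks (X : {set V}) (m : nat) (Rs : seq {set V}) :
  {in Rs, forall R : {set V}, R \subset X /\ m <= alpha R} ->
  pairwise sep Rs -> size Rs * m <= alpha X.
Proof.
elim: Rs X => [|R Rs IH] X //= hR /andP[sR pR].
have [RX mR] : R \subset X /\ m <= alpha R by apply: hR; rewrite mem_head.
pose Y := \bigcup_(Q <- Rs) Q.
have inY (x : V) : x \in Y -> exists2 Q, Q \in Rs & x \in Q.
  rewrite /Y; elim: (Rs) => [|Q Qs IQ]; first by rewrite big_nil inE.
  rewrite big_cons => /setUP[xQ|/IQ[Q' Q'Qs xQ']]; first by exists Q; rewrite ?mem_head.
  by exists Q'; rewrite // inE Q'Qs orbT.
have YX : Y \subset X.
  apply/subsetP => x /inY[Q QRs]; apply/subsetP.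
  by have [] := hR Q; rewrite ?inE ?QRs ?orbT.
have sRY : sep R Y.
  have sRQ Q : Q \in Rs -> sep R Q by move=> QRs; move/allP: sR; apply.
  apply/sepP; split.
    rewrite -setI_eq0; apply/set0Pn => -[x /setIP[xR /inY[Q /sRQ/sepP[dRQ _] xQ]]].
    by rewrite (disjointFr dRQ xR) in xQ.
  by move=> x y xR /inY[Q /sRQ/sepP[_ h] yQ]; apply: h.
rewrite mulSn; apply: leq_trans (alpha_sep RX YX sRY).
apply: leq_add => //; apply: IH => // Q QRs; split.
  by apply/subsetP => x xQ; rewrite /Y (big_rem Q) //= inE xQ.
by have [] := hR Q; rewrite ?inE ?QRs ?orbT.
Qed.

End Stable.

(** * Laminar set systems *)

Section Small.

(* A union of labels of weight about [W / g] and of the least possible cardinal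
   also has a fair share of [n]: otherwise it could be split in two. *)
Lemma group_labels (I : finType) (M : {set I}) (w n : I -> nat) (g N : nat) :
  let W := \sum_(c in M) w c in
  0 < W -> 0 < g -> \sum_(c in M) n c <= N ->
  {in M, forall c, g * w c <= W} ->
  exists2 P : {set I}, P \subset M &
    W <= 2 * g * \sum_(c in P) w c /\ g * \sum_(c in P) n c <= 2 * N.
Proof.
move=> W W0 g0 hN hw.
pose wt (P : {set I}) := \sum_(c in P) w c; pose nt (P : {set I}) := \sum_(c in P) n c.
pose big (P : {set I}) := (P \subset M) && (W <= 2 * g * wt P).
pose ok (P : {set I}) := big P && (nt P * W <= N * wt P).
have okM : ok M.
  rewrite /ok /big subxx /= -/W /wt -/W leq_mul2r hN orbT andbT.
  by rewrite leq_pmull // muln_gt0.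
have [P /andP[/andP[PM bP] nP] minP] := arg_minnP (fun P : {set I} => #|P|) okM.
exists P => //; split=> //.
have splitE (F : I -> nat) (Q : {set I}) : Q \subset P ->
    \sum_(c in P) F c = \sum_(c in Q) F c + \sum_(c in P :\: Q) F c.
  move=> QP; rewrite (big_setID Q) /=; congr (_ + _); apply: eq_bigl => c.
  by rewrite (setIidPr QP).
suff hP : g * wt P <= 2 * W.
  rewrite -/(nt P) -(leq_pmul2r W0) -mulnA.
  apply: leq_trans (leq_mul (leqnn g) nP) _.
  by rewrite mulnCA [leqRHS]mulnAC mulnC leq_mul2r hP orbT.
(* If [P] is too heavy, a minimal big [Q] inside it exceeds the threshold by at most one label, so
   [P :\: Q] is big too. By minimality of [P] both parts violate the density bound, and the sum of
   the two violations contradicts [nP]. *)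
rewrite leqNgt; apply/negP => hP.
have bigP : big P by rewrite /big PM.
have bPP : (P \subset P) && big P by rewrite subxx.
have [Q /andP[QP /andP[QM bQ]] minQ] :=
  @arg_minnP _ P (fun Q : {set I} => (Q \subset P) && big Q) (fun P : {set I} => #|P|) bPP.
have [Q0|/set0Pn[p pQ]] := eqVneq Q set0.
  by move: bQ; rewrite Q0 /wt big_set0 muln0 leqNgt W0.
have hQ : 2 * g * wt Q < 3 * W.
  have wp : 2 * g * wt (Q :\ p) < W.
    rewrite ltnNge; apply/negP => h.
    have := minQ (Q :\ p); rewrite /big h (subset_trans (subsetDl _ _) QP).
    rewrite (subset_trans (subsetDl _ _) QM) => /(_ isT).
    by rewrite (cardsD1 p Q) pQ ltnn.
  have := hw p (subsetP QM _ pQ).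
  rewrite {1}/wt (big_setD1 p) //= -/(wt _); nia.
have wS : wt P = wt Q + wt (P :\: Q) := splitE w Q QP.
have nS : nt P = nt Q + nt (P :\: Q) := splitE n Q QP.
have bD : W <= 2 * g * wt (P :\: Q) by nia.
have notok (S : {set I}) : S \subset P -> S != P -> W <= 2 * g * wt S ->
    N * wt S < nt S * W.
  move=> SP nSP bS; rewrite ltnNge; apply/negP => h.
  have := minP S; rewrite /ok /big h bS (subset_trans SP PM) => /(_ isT).
  have : S \proper P by rewrite properEneq nSP.
  by move/proper_card; rewrite ltnNge => /negbTE->.
have hD0 : P :\: Q != set0.
  by apply/eqP => D0; move: bD; rewrite D0 /wt big_set0 muln0 leqNgt W0.
have n1 : N * wt Q < nt Q * W.
  apply: notok => //; apply: contra hD0 => /eqP->; by rewrite setDv.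
have n2 : N * wt (P :\: Q) < nt (P :\: Q) * W.
  apply: notok => //; first exact: subsetDl.
  apply/negP => /eqP DE; have := subsetP QP p pQ.
  by rewrite -DE inE pQ.
nia.
Qed.

Variables (I V : finType).

Definition laminar (A B : {set V}) : bool :=
  [|| [disjoint A & B], A \subset B | B \subset A].

(* Each point is assigned the largest [S c] containing it, and [z] is the most
   frequent group.  By laminarity a set of another group lies inside a single
   piece cut out by the maximal sets of group [z]. *)
Lemma small_lemma (C : {set I}) (T : {set V}) (S : I -> {set V})
    (h g : nat) (grp : I -> 'I_h) : 0 < h -> 0 < g ->
  {in C &, forall b c, grp b != grp c -> laminar (S b) (S c)} ->
  {in C, forall c, S c \subset T /\ 2 * h * g * #|S c| <= #|T|} ->
  exists (R : {set V}) (z : 'I_h), [/\ R \subset T, #|T| <= 4 * h * g * #|R| &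
    g * #|[set c in C | (grp c != z) && ~~ [disjoint S c & R]]| <= 2 * #|C|].
Proof.
move=> h0 g0 lamS hS; pose z0 := Ordinal h0.
have [T0|Tn0] := posnP #|T|.
  exists set0, z0; rewrite sub0set T0; split=> //.
  rewrite (_ : [set _ in _ | _] = set0) ?cards0 ?muln0 //.
  by apply/setP => c; rewrite !inE disjoint_sym disjoints_subset sub0set !andbF.
pose Cov := \bigcup_(c in C) S c.
have CovT : Cov \subset T by apply/bigcupsP => c /hS[].
(* If half of [T] is left uncovered, the uncovered part meets no set at all. *)
case: (leqP #|T| (2 * #|T :\: Cov|)) => [hT|hT].
  exists (T :\: Cov), z0; split; first exact: subsetDl.
    by apply: leq_trans hT _; rewrite leq_mul2r; apply/orP; right; nia.
  rewrite (_ : [set _ in _ | _] = set0) ?cards0 ?muln0 //.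
  apply/setP => c; rewrite !inE; apply/and3P => -[cC _]; case/negP.
  rewrite -setI_eq0; apply/eqP/setP => x; rewrite !inE; apply/and3P => -[xS].
  by case/bigcupP; exists c.
have hCov : #|T| <= 2 * #|Cov|.
  have : #|T| = #|Cov| + #|T :\: Cov| by rewrite cardsD (setIidPr CovT) subnKC // subset_leq_card.
  by lia.
have [c0 c0C] : exists c0, c0 \in C.
  apply/set0Pn/eqP => C0; move: hCov; rewrite /Cov C0 big_set0 cards0; lia.
pose mx x := [arg max_(c > odflt c0 [pick c in C | x \in S c] | (c \in C) && (x \in S c)) #|S c|].
have mxP x : x \in Cov ->
    [/\ mx x \in C, x \in S (mx x) & forall c, c \in C -> x \in S c -> #|S c| <= #|S (mx x)|].
  case/bigcupP=> c1 c1C xc1; rewrite /mx; case: arg_maxnP => [|c /andP[cC xc] mc].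
    by case: pickP => //= /(_ c1); rewrite c1C xc1.
  by split=> // c2 c2C xc2; apply: mc; rewrite c2C.
pose Wz (z : 'I_h) := [set x in Cov | grp (mx x) == z].
have [z hz] : exists z, #|Cov| <= h * #|Wz z|.
  apply/existsP; apply: contraT => /existsPn hn.
  have E : #|Cov| = \sum_(z < h) #|Wz z|.
    rewrite -sum1_card (partition_big (fun x => grp (mx x)) predT) //=.
    by apply: eq_bigr => z _; rewrite -sum1_card; apply: eq_bigl => x; rewrite inE.
  have : \sum_(z < h) (h * #|Wz z|).+1 <= \sum_(z < h) #|Cov|.
    by apply: leq_sum => z _; rewrite ltnNge.
  rewrite sum_nat_const card_ord (eq_bigr (fun z => h * #|Wz z| + 1)); last by move=> z _; rewrite addn1.
  rewrite big_split /= -big_distrr /= -E sum_nat_const card_ord; lia.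
have [W memW hW0] : exists2 W : {set V}, {in W, forall x, x \in Cov /\ grp (mx x) = z} &
    #|Cov| <= h * #|W|.
  by exists (Wz z) => // x; rewrite inE => /andP[-> /eqP].
pose M := [set mx x | x in W].
have WCov x : x \in W -> x \in Cov by case/memW.
have MC m : m \in M -> m \in C /\ grp m = z.
  case/imsetP => x xW ->; split; first by case: (mxP x (WCov x xW)).
  by case: (memW x xW).
(* Two sets of group [z] may overlap arbitrarily, so the order of the labels decides which one owns
   [y]. A set of another group lies inside [S (phi y)] for each of its points [y] in [W], hence all
   these points share one label ([uniq_phi]). *)
pose phi y := [arg min_(c < mx y | (c \in M) && (y \in S c)) enum_rank c].
have phiP y : y \in W -> [/\ phi y \in M, y \in S (phi y) &
    forall c, c \in M -> y \in S c -> enum_rank (phi y) <= enum_rank c].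
  move=> yW; rewrite /phi; case: arg_minnP => [|c /andP[cM yc] mc].
    by case: (mxP y (WCov y yW)) => _ -> _; rewrite imset_f.
  by split=> // c2 c2C xc2; apply: mc; rewrite c2C.
have top x c : x \in Cov -> c \in C -> grp c != grp (mx x) -> x \in S c -> S c \subset S (mx x).
  move=> xCov cC gc xc; have [mC xm mm] := mxP x xCov.
  have /or3P[||] // := lamS _ _ cC mC gc.
    by move/disjoint_setI0/setP/(_ x); rewrite !inE xc xm.
  by move=> sub; have := mm c cC xc; rewrite -(geq_leqif (subset_leqif_card sub)).
have phiS y c : y \in W -> c \in C -> grp c != z -> y \in S c -> S c \subset S (phi y).
  move=> yW cC gc yc; have [pM yp _] := phiP y yW; have [pC gp] := MC _ pM.
  have /or3P[||] // : laminar (S c) (S (phi y)) by apply: lamS; rewrite ?gp.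
    by move/disjoint_setI0/setP/(_ y); rewrite !inE yc yp.
  case/imsetP: (pM) => x xW xE; rewrite xE => sub.
  apply: top => //; first exact: WCov.
    by rewrite (_ : grp (mx x) = z) // -xE.
  by apply: (subsetP sub); case: (mxP x (WCov x xW)).
have uniq_phi c y y' : c \in C -> grp c != z -> y \in W -> y' \in W ->
    y \in S c -> y' \in S c -> phi y = phi y'.
  move=> cC gc yW y'W yc y'c; have [pM _ pm] := phiP y yW; have [pM' _ pm'] := phiP y' y'W.
  apply: enum_rank_inj; apply/eqP; rewrite -val_eqE eqn_leq; apply/andP; split.
    by apply: pm => //; apply: (subsetP (phiS y' c y'W cC gc y'c)).
  by apply: pm' => //; apply: (subsetP (phiS y c yW cC gc yc)).
pose meets c p := [exists y in W, (phi y == p) && (y \in S c)].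
pose w p := #|[set y in W | phi y == p]|.
pose n p := #|[set c in C | (grp c != z) && meets c p]|.
have sw (P : {set I}) : \sum_(p in P) w p = #|[set y in W | phi y \in P]|.
  rewrite -[RHS]sum1_card (partition_big phi (mem P)) /=; last by move=> y; rewrite inE => /andP[].
  apply: eq_bigr => p pP; rewrite /w -sum1_card; apply: eq_bigl => y; rewrite !inE.
  by case: eqP => [->|]; rewrite ?andbF // pP !andbT.
have hW : \sum_(p in M) w p = #|W|.
  by rewrite sw; apply: eq_card => y; rewrite inE; case: (boolP (y \in W)) => //= /phiP[].
have W0 : 0 < #|W| by rewrite lt0n; apply/eqP => E; move: hW0; rewrite E; lia.
(* By [uniq_phi], each index outside group [z] is counted for at most one label. *)
have hn : \sum_(p in M) n p <= #|C|.
  have -> : \sum_(p in M) n p =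
      \sum_(c in C | grp c != z) #|[set p in M | meets c p]|.
    under eq_bigr do rewrite /n -sum1_card.
    under [RHS]eq_bigr do rewrite -sum1_card.
    rewrite (exchange_big_dep (fun c => (c \in C) && (grp c != z))) /=; last first.
      by move=> p c _; rewrite inE => /and3P[-> ->].
    apply: eq_bigr => c /andP[cC gc]; apply: eq_bigl => p; rewrite !inE cC gc //.
  rewrite -[#|C|]sum1_card big_mkcondr; apply: leq_sum => c cC; case: ifP => // gc.
  apply/card_le1_eqP => p q; rewrite !inE => /andP[_ /existsP[y /and3P[yW /eqP<- yc]]].
  by case/andP=> _ /existsP[y' /and3P[y'W /eqP<- y'c]]; apply: (uniq_phi c).
have hw : {in M, forall p, g * w p <= #|W|}.
  move=> p pM; have [pC _] := MC p pM; have [_ hp] := hS p pC.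
  have : w p <= #|S p|.
    apply: subset_leq_card; apply/subsetP => y; rewrite inE => /andP[yW /eqP<-].
    by case: (phiP y yW).
  move=> wp; rewrite -(leq_pmul2l (_ : 0 < 2 * h)); last by lia.
  have : 2 * h * (g * w p) <= 2 * h * g * #|S p| by rewrite mulnA leq_mul2l wp orbT.
  by lia.
rewrite -hW in W0; have [|P PM [bP nP]] := group_labels W0 g0 hn.
  by move=> p /hw; rewrite hW.
exists [set y in W | phi y \in P], z; split.
- by apply/subsetP => y; rewrite inE => /andP[/WCov/(subsetP CovT)].
- rewrite -sw; rewrite hW in bP.
  have := leq_mul (leqnn h) bP; lia.
apply: leq_trans nP; rewrite leq_mul2l; apply/orP; right.
have sub : [set c in C | (grp c != z) && ~~ [disjoint S c & [set y in W | phi y \in P]]]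
    \subset \bigcup_(p in P) [set c in C | (grp c != z) && meets c p].
  apply/subsetP => c; rewrite inE => /and3P[cC gc].
  rewrite -setI_eq0 => /set0Pn[y]; rewrite !inE => /and3P[yc yW yP].
  apply/bigcupP; exists (phi y) => //; rewrite inE cC gc /=.
  by apply/existsP; exists y; rewrite yW eqxx.
exact: leq_trans (subset_leq_card sub) (card_bigcup_leq _ _).
Qed.

End Small.

(** * Crossing traces *)

Lemma exists_popular (I V : finType) (C : {set I}) (T : {set V}) (S : I -> {set V}) (k : nat) :
  T != set0 -> {in C, forall c, S c \subset T /\ #|T| <= k * #|S c|} ->
  exists2 x, x \in T & #|C| <= k * #|[set c in C | x \in S c]|.
Proof.
move=> T0 hS; apply/exists_inP; apply: contraT => /exists_inPn hn.
have E : \sum_(x in T) #|[set c in C | x \in S c]| = \sum_(c in C) #|S c|.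
  under eq_bigr do rewrite -sum1_card.
  under [RHS]eq_bigr do rewrite -sum1_card.
  rewrite (exchange_big_dep (mem C)) /=; last by move=> x c _; rewrite inE => /andP[].
  apply: eq_bigr => c cC; apply: eq_bigl => x; rewrite inE cC /= andb_idl //.
  by apply/subsetP; case: (hS c cC).
have h1 : #|C| * #|T| <= k * \sum_(c in C) #|S c|.
  by rewrite big_distrr -sum_nat_const; apply: leq_sum => c /hS[].
have : \sum_(x in T) (k * #|[set c in C | x \in S c]|).+1 <= \sum_(x in T) #|C|.
  by apply: leq_sum => x xT; rewrite ltnNge; apply: hn.
under eq_bigr do rewrite -addn1.
rewrite big_split /= -big_distrr /= E !sum_nat_const.
by move: T0; rewrite -card_gt0; lia.
Qed.

Section Tri.

Variables (I J V : finType).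

(** For [A] and [B] inside [T] this fails exactly when the four regions of their Venn diagram in [T]
    are all inhabited. *)
Definition cross (T A B : {set V}) : bool := laminar A B || (T \subset A :|: B).

(** Fix a point lying in many sets and a smallest set [S c1] through it. A set through this point
    with another [col] is not disjoint from [S c1], and by minimality not properly inside it; so it
    contains [S c1] or, in the covering case, the complement of [S c1] in [T]. *)
Lemma mid_lemma (C : {set I}) (T : {set V}) (S : I -> {set V}) (col : I -> J)
    (k t0 : nat) : 0 < k -> C != set0 ->
  (forall z, #|[set c in C | col c == z]| <= t0) ->
  {in C &, forall b c, col b != col c -> cross T (S b) (S c)} ->
  {in C, forall c, [/\ S c \subset T, #|T| <= k * #|S c| & #|T| <= k * #|T :\: S c|]} ->
  exists X : {set V}, [/\ X \subset T, #|T| <= k * #|X| &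
    #|C| <= k * (t0 + 2 * #|[set c in C | X \subset S c]|)].
Proof.
move=> k0 Cn0 hcol hcr hS.
have [T0|Tn0] := eqVneq T set0.
  exists set0; rewrite T0 subxx cards0 muln0; split=> //.
  rewrite (_ : [set c in C | _] = C); first by nia.
  by apply/setP => c; rewrite inE sub0set andbT.
have [x0 x0T hx0] := @exists_popular _ _ C T S k Tn0
  (fun c cC => let: And3 h1 h2 _ := hS c cC in conj h1 h2).
set C0 := [set c in C | x0 \in S c] in hx0.
have [c0 c0C] : exists c, c \in C0.
  apply/set0Pn; apply: contraNneq Cn0 => C00.
  by rewrite -cards_eq0; move: hx0; rewrite C00 cards0; lia.
have [c1 c1C min1] := @arg_minnP _ c0 (fun c => c \in C0) (fun c => #|S c|) c0C.
have [c1C' x01] : c1 \in C /\ x0 \in S c1 by move: c1C; rewrite inE => /andP.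
have [S1T h1 h1'] := hS c1 c1C'.
pose N (X : {set V}) := [set c in C | X \subset S c].
have sub : C0 \subset [set c in C | col c == col c1] :|: (N (S c1) :|: N (T :\: S c1)).
  apply/subsetP => c cC0; move: (cC0); rewrite !inE => /andP[cC x0c]; rewrite cC /=.
  case: eqP => //= /eqP ne; have := hcr _ _ cC c1C' ne.
  case/orP => [/or3P[||->//]|].
  - by move/disjoint_setI0/setP/(_ x0); rewrite !inE x0c x01.
  - move=> sub; have := min1 c cC0; rewrite -(geq_leqif (subset_leqif_card sub)).
    by rewrite /N => ->.
  by rewrite setUC -subDset => ->; rewrite orbT.
have := leq_trans (subset_leq_card sub) (card_setU_leq _ _).
have := card_setU_leq (N (S c1)) (N (T :\: S c1)); have := hcol (col c1).
move: (#|N _ :|: _|) => n n0 n1 n2.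
case: (leqP #|N (T :\: S c1)| #|N (S c1)|) => hN.
  exists (S c1); split => //; apply: leq_trans hx0 _; rewrite leq_mul2l -/(N _); apply/orP; right; lia.
exists (T :\: S c1); split => //; first exact: subsetDl.
apply: leq_trans hx0 _; rewrite leq_mul2l -/(N _); apply/orP; right; lia.
Qed.

(* The columns whose trace is neither small nor co-small are handled by
   [mid_lemma], the co-small ones by taking complements in [small_lemma]. *)
Lemma tri_lemma (C : {set I}) (T : {set V}) (S : I -> {set V}) (col : I -> J)
    (q t0 : nat) (grp : I -> 'I_q) : 8 <= q -> C != set0 -> T != set0 ->
  (forall z, #|[set c in C | col c == z]| <= t0) -> 4 * q ^ 3 * t0 <= #|C| ->
  (forall z, q * #|[set c in C | grp c == z]| <= 4 * #|C|) ->
  (forall b c, grp b != grp c -> col b != col c) ->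
  {in C &, forall b c, col b != col c -> cross T (S b) (S c)} ->
  {in C, forall c, S c \subset T} ->
  (exists R : {set V}, [/\ R \subset T, #|T| <= 4 * q ^ 2 * #|R| &
     q * #|[set c in C | ~~ [disjoint S c & R]]| <= 15 * #|C|]) \/
  (exists X : {set V}, [/\ X \subset T, #|T| <= 4 * q ^ 2 * #|X| &
     #|C| <= 8 * q ^ 3 * #|[set c in C | X \subset S c]|]).
Proof.
move=> q8 Cn0 Tn0 hcol ht0 hgrp gc hcr hS.
pose k := 2 * q ^ 2; have k0 : 0 < k by rewrite muln_gt0 expn_gt0; lia.
have q0 : 0 < q by lia.
have C0 : 0 < #|C| by rewrite card_gt0.
pose Cs := [set c in C | k * #|S c| <= #|T|].
pose Cc := [set c in C | k * #|T :\: S c| <= #|T|].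
pose Cm := [set c in C | (#|T| < k * #|S c|) && (#|T| < k * #|T :\: S c|)].
have subcol (C' : {set I}) z : C' \subset C ->
    #|[set c in C' | col c == z]| <= #|[set c in C | col c == z]|.
  move=> C'C; apply/subset_leq_card/subsetP => c; rewrite !inE => /andP[cC' ->].
  by rewrite (subsetP C'C).
have [hm|hm] := leqP #|C| (q * #|Cm|).
  have CmC : Cm \subset C by apply/subsetP => c; rewrite inE => /andP[].
  have [||||X [XT hX hN]] := @mid_lemma Cm T S col k t0 k0.
  - by rewrite -card_gt0; lia.
  - by move=> z; apply: leq_trans (hcol z); apply: subcol.
  - by move=> b c /(subsetP CmC) bC /(subsetP CmC) cC; apply: hcr.
  - move=> c; rewrite inE => /and3P[cC h1 h2]; split; [exact: hS|lia|lia].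
  right; exists X; split=> //; first by apply: leq_trans hX _; rewrite leq_mul2r; apply/orP; right; rewrite /k; lia.
  have : #|[set c in Cm | X \subset S c]| <= #|[set c in C | X \subset S c]|.
    by apply/subset_leq_card/subsetP => c; rewrite !inE => /andP[/andP[-> _] ->].
  move: hm hN ht0; rewrite /k !expnS expn0 !muln1.
  move: #|Cm| #|[set c in Cm | _]| #|[set c in C | _]| #|C| => a b c d h1 h2 h3 h4.
  have h5 : q * a <= q * (2 * (q * q) * (t0 + 2 * c)).
    by rewrite leq_mul2l (leq_trans h2) ?orbT // !leq_mul2l leq_add2l leq_mul2l h4 !orbT.
  by lia.
have [hc|hc] := leqP (8 * #|C|) (q * #|Cc|).
    have CcC : Cc \subset C by apply/subsetP => c; rewrite inE => /andP[].
  have small c : c \in Cc -> 2 * q * q * #|T :\: S c| <= #|T|.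
    by rewrite inE /k => /andP[_]; lia.
  have Tgt0 : 0 < #|T| by rewrite card_gt0.
  have small64 c : c \in Cc -> 64 * #|T :\: S c| <= #|T|.
    by move/small; apply: leq_trans; rewrite leq_mul2r -mulnA; apply/orP; right; clear -q8; nia.
  have [|c cC|R [z [RT hR hN]]] := @small_lemma _ _ Cc T (fun c => T :\: S c) q q grp q0 q0.
  - move=> b c bC cC gbc; have [bC' cC'] := (subsetP CcC _ bC, subsetP CcC _ cC).
    have [SbT ScT] := (hS b bC', hS c cC').
    have := hcr _ _ bC' cC' (gc _ _ gbc); rewrite /cross /laminar -!orbA.
    case/or4P => [dis|sub|sub|cov]; apply/or3P.
    (* Co-small sets cannot be disjoint, as their complements are too small to cover [T]. The three
       other cases turn into laminarity of the complements. *)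
    + have := subset_leq_card (_ : T \subset (T :\: S b) :|: (T :\: S c)).
      rewrite -setDIr (disjoint_setI0 dis) setD0 subxx => /(_ isT).
      have := card_setU_leq (T :\: S b) (T :\: S c).
      rewrite -setDIr (disjoint_setI0 dis) setD0 => h _.
      move: (small64 _ bC) (small64 _ cC) Tgt0 h; clear; lia.
    + by apply: Or33; apply: setDS.
    + by apply: Or32; apply: setDS.
    + apply: Or31; rewrite -setI_eq0; apply/eqP/setP => x; rewrite !inE.
      apply/negP => /andP[/andP[xb xT] /andP[xc _]].
      by have := subsetP cov x xT; rewrite inE (negbTE xb) (negbTE xc).
  - by split; [exact: subsetDl|apply: small].
  right; exists R; split=> //; first by apply: leq_trans hR _; rewrite expnS expn1 mulnA.
  have sub : Cc \subset [set c in C | R \subset S c] :|: ([set c in C | grp c == z] :|: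
     [set c in Cc | (grp c != z) && ~~ [disjoint T :\: S c & R]]).
    apply/subsetP => c cC; have cC' := subsetP CcC _ cC.
    rewrite in_setU in_setU [c \in [set c in C | R \subset _]]inE.
    rewrite [c \in [set c in C | _ == z]]inE [c \in [set c in Cc | _]]inE cC cC' /=.
    case: eqP => _ /=; first by rewrite orbT.
    have [dis|_] := boolP [disjoint T :\: S c & R]; last by rewrite orbT.
    rewrite orbF; apply/subsetP => x xR; apply: contraT => nx.
    by rewrite -(disjointFl dis xR) !inE nx (subsetP RT).
  have := leq_trans (subset_leq_card sub) (card_setU_leq _ _).
  have h1 := card_setU_leq [set c in C | grp c == z]
     [set c in Cc | (grp c != z) && ~~ [disjoint T :\: S c & R]].
  move=> h2; have h3 := leq_trans h2 (leq_add (leqnn _) h1).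
  have h4 := subset_leq_card CcC; have h5 := hgrp z.
  have h6 := leq_mul (leqnn q) h3.
  have h7 : #|C| <= q * #|[set c in C | R \subset S c]| by lia.
  apply: leq_trans h7 _; rewrite leq_mul2r; apply/orP; right.
  by rewrite !expnS expn0 !muln1; nia.
have CsC : Cs \subset C by apply/subsetP => c; rewrite inE => /andP[].
have small c : c \in Cs -> 2 * q * q * #|S c| <= #|T|.
  by rewrite inE /k => /andP[_]; lia.
have Tgt0 : 0 < #|T| by rewrite card_gt0.
have small64 c : c \in Cs -> 64 * #|S c| <= #|T|.
  by move/small; apply: leq_trans; rewrite leq_mul2r -mulnA; apply/orP; right; clear -q8; nia.
have [|c cC|R [z [RT hR hN]]] := @small_lemma _ _ Cs T S q q grp q0 q0.
- move=> b c bC cC gbc; have [bC' cC'] := (subsetP CsC _ bC, subsetP CsC _ cC).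
  have := hcr _ _ bC' cC' (gc _ _ gbc); rewrite /cross; case/orP => // cov.
  have := leq_trans (subset_leq_card cov) (card_setU_leq _ _).
  move: (small64 _ bC) (small64 _ cC) Tgt0; clear; lia.
- by split; [apply: hS; apply: (subsetP CsC)|apply: small].
left; exists R; split=> //; first by apply: leq_trans hR _; rewrite expnS expn1 mulnA.
(* The constant is [15 = 1 + 8 + 4 + 2], from [Cm], [Cc], the group [z] and the exceptions of
   [small_lemma]. *)
have sub : [set c in C | ~~ [disjoint S c & R]] \subset
   (Cm :|: Cc) :|: ([set c in C | grp c == z] :|:
   [set c in Cs | (grp c != z) && ~~ [disjoint S c & R]]).
  apply/subsetP => c; rewrite !inE => /andP[cC dis]; rewrite cC dis /=.
  by case: (leqP _ #|T|) => _; case: (leqP _ #|T|) => _; rewrite ?orbT //= ?orbF andbT orbN.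
have h1 := leq_trans (subset_leq_card sub) (card_setU_leq _ _).
have h2 := card_setU_leq Cm Cc.
have h3 := card_setU_leq [set c in C | grp c == z]
   [set c in Cs | (grp c != z) && ~~ [disjoint S c & R]].
have h4 := leq_trans h1 (leq_add h2 h3).
have h5 := subset_leq_card CsC; have h6 := hgrp z.
have h7 := leq_mul (leqnn q) h4; lia.
Qed.

End Tri.

(** * Combs in set systems *)

Lemma subset_of_card (V : finType) (A : {set V}) (t : nat) :
  t <= #|A| -> exists2 B : {set V}, B \subset A & #|B| = t.
Proof.
move=> tA; have ut : uniq (take t (enum A)) by rewrite take_uniq ?enum_uniq.
exists [set x in take t (enum A)].
  by apply/subsetP => x; rewrite inE => /mem_take; rewrite mem_enum.
by rewrite cardsE; move/card_uniqP: ut => ->; rewrite size_takel // -cardE.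
Qed.

Section Comb.

Variables (I V : finType) (F : I -> {set V}).

Fixpoint glist (c M : nat) (cur : {set V}) (l : seq I) : bool :=
  if l is a :: l' then (M < c * #|F a :&: cur|) && glist c M (cur :\: F a) l' else true.

(** The list is processed from its end. A head [a] is kept when at least half of its fresh part [P]
    avoids the sets already kept, and that half becomes its tooth. Otherwise the kept sets cover
    more than half of [P], and the sum on the right grows by enough to pay for the rejected element.
    Earlier teeth avoid [F a] because they live in [cur :\: F a]. *)
Lemma comb_of_list (c M : nat) (cur : {set V}) (l : seq I) : glist c M cur l ->
  exists (K : {set I}) (T : I -> {set V}), [/\ {subset K <= l},
    {in K, forall a, T a \subset F a :&: cur /\ M < 2 * c * #|T a|},
    {in K &, forall a b, a != b -> [disjoint T a & F b]} &
    size l * M <= #|K| * M + 2 * c * \sum_(a in K) #|F a :&: cur|].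
Proof.
elim: l cur => [|a l IH] cur /=.
  by exists set0, (fun _ => set0); split=> // x; rewrite inE.
case/andP => hP /IH[K [T [Kl hT dT hK]]].
pose P := F a :&: cur; pose U := \bigcup_(x in K) F x.
have naK : a \notin K.
  apply/negP => aK; have [sub h] := hT a aK; move: h.
  rewrite (_ : T a = set0) ?cards0 ?muln0 //; apply/setP => x; rewrite inE.
  by apply/negP => /(subsetP sub); rewrite !inE; case: (x \in F a).
have dTa x : x \in K -> [disjoint T x & F a].
  move=> xK; have [sub _] := hT x xK; rewrite disjoint_subset; apply/subsetP => y.
  by move/(subsetP sub); rewrite !inE => /and3P[].
have hT' x : x \in K -> T x \subset F x :&: cur /\ M < 2 * c * #|T x|.
  move=> xK; have [sub h] := hT x xK; split=> //; apply: subset_trans sub _.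
  by apply: setIS; apply: subsetDl.
have sumE : \sum_(x in K) #|F x :&: cur| =
    \sum_(x in K) #|F x :&: (cur :\: F a)| + \sum_(x in K) #|F x :&: P|.
  rewrite -big_split; apply: eq_bigr => x _ /=.
  rewrite -(cardsID (F a) (F x :&: cur)) addnC; congr (_ + _); apply: eq_card => y;
    by rewrite !inE; do ![case: (_ \in _)].
have [hacc|hrej] := leqP (2 * #|P :&: U|) #|P|.
  exists (a |: K), (fun x => if x == a then P :\: U else T x); split.
  - by move=> x /setU1P[->|/Kl]; rewrite inE ?eqxx // => ->; rewrite orbT.
  - move=> x /setU1P[->|xK].
      rewrite eqxx; split; first exact: subsetDl.
      by move: hP; rewrite cardsD -/P; nia.
    by case: eqP => [xa|_]; [rewrite -xa xK in naK|apply: hT'].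
  - move=> x y /setU1P[->|xK] /setU1P[->|yK]; rewrite ?eqxx // => nxy.
      rewrite disjoint_subset; apply/subsetP => z; rewrite !inE => /andP[+ _].
      by apply: contra => zy; apply/bigcupP; exists y.
    case: eqP => [xa|_]; first by rewrite -xa xK in naK.
    by apply: dTa.
    case: eqP => [xa|_]; first by rewrite -xa xK in naK.
    exact: dT.
  rewrite big_setU1 //= cardsU1 naK sumE; nia.
exists K, T; split=> //.
  by move=> x /Kl; rewrite inE => ->; rewrite orbT.
have hU : #|P :&: U| <= \sum_(x in K) #|F x :&: P|.
  rewrite /U big_distrr /=; apply: leq_trans (card_bigcup_leq _ _) _.
  by apply: leq_sum => x _; rewrite setIC.
rewrite sumE mulSn; rewrite -/P in hP; nia.
Qed.

(** Sets capturing more than [M / c] remaining points are removed as long as there are any. The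
    hypothesis at scale [c'] caps each capture by [M / c'], which bounds the total loss. *)
Lemma greedy (A : {set I}) (c c' M : nat) (cur : {set V}) :
  {in A, forall a, c' * #|F a :&: cur| <= M} ->
  exists (l : seq I) (cur' : {set V}), [/\ {subset l <= A}, glist c M cur l,
    cur' \subset cur, {in A, forall a, c * #|F a :&: cur'| <= M} &
    c' * #|cur| <= c' * #|cur'| + size l * M].
Proof.
have [n le_n] := ubnP #|cur|; elim: n cur le_n => // n IH cur le_n hc'.
have [/existsP[a /andP[aA ha]]|hn] := boolP [exists a, (a \in A) && (M < c * #|F a :&: cur|)].
  have hF := hc' a aA.
  have E : #|cur| = #|F a :&: cur| + #|cur :\: F a| by rewrite -(cardsID (F a)) setIC.
  have [||l [cur' [lA gl sub hc hs]]] := IH (cur :\: F a).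
  - by have : 0 < #|F a :&: cur| by [nia]; lia.
  - move=> b /hc'; apply: leq_trans; rewrite leq_mul2l; apply/orP; right.
    by apply/subset_leq_card/setIS/subsetDl.
  exists (a :: l), cur'; split=> //=.
  - by move=> x; rewrite inE => /predU1P[->|/lA].
  - by rewrite ha.
  - exact: subset_trans sub (subsetDl _ _).
  by rewrite E mulSn; nia.
exists [::], cur; split=> //; last by rewrite mul0n addn0.
move=> a aA; rewrite leqNgt; apply: contra hn => ha.
by apply/existsP; exists a; rewrite aA.
Qed.

Definition comb (A : {set I}) (B : {set V}) (L : nat) : Prop :=
  exists (K : {set I}) (T : I -> {set V}) (t : nat), [/\ K \subset A,
    {in K, forall a, T a \subset F a :&: B /\ #|T a| = t},
    {in K &, forall a b, a != b -> [disjoint T a & F b]},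
    L <= 36 * #|K| & #|B| * L <= (72 * #|K|) ^ 2 * t].

(* Sweep [B] greedily at scales [|B| / (L 4 ^ h)]; some scale must use at least
   [L 2 ^ h / 4] sets, since otherwise nothing is left to be covered. *)
Lemma comb_lemma (A : {set I}) (B : {set V}) (L : nat) : 0 < L -> B != set0 ->
  {in B, forall b, exists2 a, a \in A & b \in F a} ->
  {in A, forall a, L * #|F a :&: B| <= 2 * #|B|} -> comb A B L.
Proof.
move=> L0 Bn0 cov hL; have B0 : 0 < #|B| by rewrite card_gt0.
(* At [h = 0] and [cur = B] the left alternative is absurd. Here [n] counts the scales still
   available; when none is left, the bound on [F a :&: cur] is below one point, so [cur] is
   empty. *)
suff H n h (cur : {set V}) : 2 * #|B| < L * 4 ^ (h + n) -> cur \subset B ->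
    {in A, forall a, L * 4 ^ h * #|F a :&: cur| <= 2 * #|B|} ->
    2 ^ h * #|cur| < #|B| \/ comb A B L.
  have [| | |h1|//] := H (2 * #|B|) 0 B.
  - by apply: leq_trans (ltn_expl _ (isT : 1 < 4)) _; apply: leq_pmull.
  - exact: subxx.
  - by move=> a aA; rewrite expn0 muln1; apply: hL.
  by move: h1; rewrite expn0 mul1n ltnn.
elim: n h cur => [|n IH] h cur.
  rewrite addn0 => hbig curB hcur; left.
  rewrite (_ : cur = set0) ?cards0 ?muln0 //; apply/setP => x; rewrite inE.
  apply/negP => xc; have [a aA xa] := cov x (subsetP curB x xc).
  have : 0 < #|F a :&: cur| by apply/card_gt0P; exists x; rewrite inE xa.
  have := hcur a aA; nia.
move=> hbig curB hcur.
have [l [cur' [lA gl sub hc hs]]] := @greedy A (L * 4 ^ h.+1) (L * 4 ^ h) (2 * #|B|) cur hcur.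
have [hlong|hshort] := leqP (L * 2 ^ h) (4 * size l).
  right; have [K [T [Kl hT dT hK]]] := comb_of_list gl.
  (* In [hK] the coefficient [2 * c] is eight times [L * 4 ^ h], and the sum times [L * 4 ^ h] is at
     most [#|K| * (2 * #|B|)]; together with the first summand this gives [9 = 1 + 8]. *)
  have hl : size l <= 9 * #|K|.
    have : L * 4 ^ h * \sum_(a in K) #|F a :&: cur| <= #|K| * (2 * #|B|).
      rewrite big_distrr -sum_nat_const; apply: leq_sum => a /Kl/lA; exact: hcur.
    move: hK; rewrite expnS => hK hsum.
    rewrite -(leq_pmul2r (_ : 0 < 2 * #|B|)) //; last by lia.
    by lia.
  pose t := #|B| %/ (L * 4 ^ h.+1) + 1.
  have d0 : 0 < L * 4 ^ h.+1 by rewrite muln_gt0 L0 expn_gt0.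
  have ht a : a \in K -> t <= #|T a|.
    by case/hT => _; rewrite /t addn1 ltn_divLR // mulnC; lia.
  pose T' a := odflt set0 [pick U : {set V} | (U \subset T a) && (#|U| == t)].
  have T'P a : a \in K -> T' a \subset T a /\ #|T' a| = t.
    move/ht => h1; have [U US cU] := subset_of_card h1.
    rewrite /T'; case: pickP => [W /andP[WT /eqP //]|/(_ U)].
    by rewrite US cU eqxx.
  exists K, T', t; split.
  - by apply/subsetP => a /Kl/lA.
  - move=> a aK; have [h1 h2] := T'P a aK; split=> //.
    apply: subset_trans h1 _; have [h3 _] := hT a aK; apply: subset_trans h3 _.
    exact: setIS.
  - move=> a b aK bK nab; apply: disjointWl (dT a b aK bK nab).
    by case: (T'P a aK).
  - have : L * 1 <= L * 2 ^ h by rewrite leq_mul2l expn_gt0 orbT.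
    by lia.
  have h1 : #|B| < L * 4 ^ h.+1 * t.
    by rewrite mulnC /t addn1 -ltn_divLR.
  have h2 : L * 2 ^ h <= 36 * #|K| by lia.
  have h3 := leq_mul h2 h2.
  have h4 : 2 ^ h * 2 ^ h = 4 ^ h by rewrite -expnMn.
  have h5 : L * (L * 4 ^ h.+1 * t) <= (72 * #|K|) ^ 2 * t.
    rewrite mulnA leq_mul2r; apply/orP; right.
    by rewrite !expnS expn0 muln1 -h4; lia.
  apply: leq_trans h5; rewrite mulnC leq_mul2l; apply/orP; right; exact: ltnW.
have [||h1|] := IH h.+1 cur' _ (subset_trans sub curB); last by right.
- by rewrite addSnnS.
- exact: hc.
(* A short list removes less than half of [#|B| / 2 ^ h], and by induction what remains is below the
   other half. *)
left; have p0 : 0 < 2 ^ h by rewrite expn_gt0.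
have h4 : 4 ^ h = 2 ^ h * 2 ^ h by rewrite -expnMn.
move: hs h1; rewrite h4 expnS; move: (2 ^ h) p0 hshort => p p0 hshort hs h1.
rewrite -(ltn_pmul2l (_ : 0 < L * p)); last by rewrite muln_gt0 L0.
nia.
Qed.

End Comb.

(** * Shattering and combs *)

(** Stable sets of [compl_rel e] are the cliques of [e], so [alpha (compl_rel e)] is the clique
    number. *)
Definition compl_rel (V : finType) (e : rel V) : rel V := fun x y => (x != y) && ~~ e x y.

(* Rows must avoid the columns, so that the condition passes to the complement. *)
Definition shatters3 (V : finType) (e : rel V) (x y z : V) : Prop :=
  uniq [:: x; y; z] /\ forall b c d : bool, exists a : V,
    [/\ a \notin [:: x; y; z], e a x = b, e a y = c & e a z = d].

Definition no_shatter3 (V : finType) (e : rel V) : Prop :=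
  forall x y z, ~ shatters3 e x y z.

Lemma compl_rel_sym (V : finType) (e : rel V) : symmetric e -> symmetric (compl_rel e).
Proof. by move=> sym x y; rewrite /compl_rel eq_sym sym. Qed.

Lemma compl_rel_irr (V : finType) (e : rel V) : irreflexive (compl_rel e).
Proof. by move=> x; rewrite /compl_rel eqxx. Qed.

Lemma compl_relK (V : finType) (e : rel V) : irreflexive e ->
  compl_rel (compl_rel e) =2 e.
Proof.
move=> irr x y; rewrite /compl_rel negb_and !negbK.
by case: eqVneq => [->|]; rewrite ?irr.
Qed.

Lemma no_shatter3_compl (V : finType) (e : rel V) :
  no_shatter3 e -> no_shatter3 (compl_rel e).
Proof.
move=> h x y z [u hs]; apply: (h x y z); split=> // b c d.
have [a [na hx hy hz]] := hs (~~ b) (~~ c) (~~ d); exists a; split=> //.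
- by move: na hx; rewrite /compl_rel !inE !negb_or => /and3P[-> _ _] /negb_inj.
- by move: na hy; rewrite /compl_rel !inE !negb_or => /and3P[_ -> _] /negb_inj.
by move: na hz; rewrite /compl_rel !inE !negb_or => /and3P[_ _ ->] /negb_inj.
Qed.

Lemma vc_no_shatter3 (G : fin_graph) : vc_dim_le 2 G -> no_shatter3 (@adj G).
Proof.
move=> h x y z [u hs]; apply: h; exists [tuple x; y; z]; split=> // eps.
have [a [_ h0 h1 h2]] := hs (tnth eps ord0) (tnth eps (inord 1)) (tnth eps (inord 2)).
exists a => i; rewrite (tnth_nth x).
case: i => [[|[|[|//]]] hi] /=; rewrite ?h0 ?h1 ?h2; congr tnth; apply: val_inj => //=;
  by rewrite inordK.
Qed.

(** * Shattered triples in a comb *)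

Section Family.

Variables (V : finType) (e : rel V).
Hypotheses (sym : symmetric e) (irr : irreflexive e).

Lemma nonadjacent_pair (X V0 : {set V}) : X \subset V0 ->
  alpha (compl_rel e) V0 < #|X| -> exists x y, [/\ x \in X, y \in X, x != y & ~~ e x y].
Proof.
move=> XV; rewrite ltnNge => hX.
have : ~~ stab (compl_rel e) X by apply: contra hX; apply: leq_alpha.
case/forall_inPn=> x xX /forall_inPn[y yX]; rewrite negbK => /andP[nxy nexy].
by exists x, y.
Qed.

Variables (V0 : {set V}) (w : V).

Definition comb_fam (J : {set V}) (T : V -> {set V}) (t : nat) : Prop :=
  [/\ J \subset V0, stab e J, {in J, forall a, a != w /\ ~~ e w a},
   {in J, forall a, T a \subset V0 :&: nb e w :&: nb e a /\ #|T a| = t} &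
   {in J &, forall a b, a != b -> [disjoint T a & nb e b]}].

Hypothesis hVC : no_shatter3 e.
Hypothesis far : {in V0 & &, forall x y z,
  exists u, [/\ u \notin [:: x; y; z], ~~ e u x, ~~ e u y & ~~ e u z]}.

Variables (J : {set V}) (T : V -> {set V}) (t : nat).
Hypothesis fam : comb_fam J T t.

Lemma famE a b : a \in J -> b \in T a -> [/\ b \in V0, e w b & e a b].
Proof.
case: fam => _ _ _ hT _ aJ bT; case: (hT a aJ) => /subsetP/(_ b bT).
by rewrite !inE => /andP[/andP[-> ->] ->].
Qed.

Lemma fam_dis a a' b : a \in J -> a' \in J -> a != a' -> b \in T a -> ~~ e a' b.
Proof.
case: fam => _ _ _ _ hd aJ a'J na bT; have /disjointFr/(_ bT) := hd a a' aJ a'J na.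
by rewrite inE => ->.
Qed.

Lemma fam_nadj a b : a \in J -> b \in J -> ~~ e a b.
Proof. by case: fam => _ /stabP sJ _ _ _; apply: sJ. Qed.

Lemma fam_neq a a' b : a \in J -> a' \in J -> b \in T a -> (b != a') && (b != w).
Proof.
case: fam => _ _ hw _ _ aJ a'J bT; have [_ wb ab] := famE aJ bT.
have [_ nw] := hw a' a'J.
by apply/andP; split; apply/eqP => E; [rewrite -E wb in nw|rewrite E irr in wb].
Qed.

Lemma fam_tooth_neq a a' b b' : a \in J -> a' \in J -> a != a' -> b \in T a -> b' \in T a' ->
  b != b'.
Proof.
move=> aJ a'J na bT b'T; apply/eqP => E; have := fam_dis aJ a'J na bT.
by have [_ _] := famE a'J b'T; rewrite E => ->.
Qed.

Lemma fam_cross a a' a'' b c : a \in J -> a' \in J -> a'' \in J ->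
  a != a' -> a != a'' -> a' != a'' -> b \in T a' -> c \in T a'' ->
  cross (T a) (nb e b :&: T a) (nb e c :&: T a).
Proof.
move=> aJ a'J a''J n1 n2 n3 bT cT; apply: contraT.
case/norP=> /norP[h1 /norP[h2 h3]] h4.
have [bV wb a'b] := famE a'J bT; have [cV wc a''c] := famE a''J cT.
have aV : a \in V0 by case: fam => /subsetP h _ _ _ _; apply: h.
have [aw nwa] : a != w /\ ~~ e w a by case: fam => _ _ h _ _; apply: h.
have /andP[ba bw] := fam_neq a'J aJ bT; have /andP[ca cw] := fam_neq a''J aJ cT.
have /andP[ba' _] := fam_neq a'J a'J bT; have /andP[ca' _] := fam_neq a''J a'J cT.
have /andP[ba'' _] := fam_neq a'J a''J bT; have /andP[ca'' _] := fam_neq a''J a''J cT.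
have nbc := fam_tooth_neq a'J a''J n3 bT cT.
have row x : x \in T a -> x \notin [:: a; b; c].
  move=> xT; have /andP[xa _] := fam_neq aJ aJ xT.
  rewrite !inE (negbTE xa) (negbTE (fam_tooth_neq aJ a'J n1 xT bT)).
  by rewrite (negbTE (fam_tooth_neq aJ a''J n2 xT cT)).
have ea x : x \in T a -> e x a by move=> xT; have [_ _] := famE aJ xT; rewrite sym.
have [x [xT xb xc]] : exists x, [/\ x \in T a, e x b & e x c].
  move: h1; rewrite -setI_eq0 => /set0Pn[x]; rewrite !inE => /andP[/andP[xb xT] /andP[xc _]].
  by exists x; rewrite ![e x _]sym.
have [y [yT yb yc]] : exists x, [/\ x \in T a, e x b & ~~ e x c].
  case/subsetPn: h2 => v; rewrite !inE => /andP[vb vT]; rewrite vT andbT => vc.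
  by exists v; rewrite ![e v _]sym.
have [z [zT zb zc]] : exists x, [/\ x \in T a, ~~ e x b & e x c].
  case/subsetPn: h3 => v; rewrite !inE => /andP[vb vT]; rewrite vT andbT => vc.
  by exists v; rewrite ![e v _]sym.
have [u [uT ub uc]] : exists x, [/\ x \in T a, ~~ e x b & ~~ e x c].
  case/subsetPn: h4 => v vT; rewrite !inE vT !andbT => /norP[vb vc].
  by exists v; rewrite ![e v _]sym.
have [v [nv va vb vc]] := far aV bV cV.
case: (hVC (x := a) (y := b) (z := c)); split.
  by rewrite /= !inE negb_or ![a == _]eq_sym ba ca nbc.
(* The rows with [a] come from the four regions of [T a]. Without [a], [w] sees both [b] and [c],
   [a'] only [b], [a''] only [c], and [v] neither. *)
move=> [] [] [].
- by exists x; rewrite row // ea // xb xc.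
- by exists y; rewrite row // ea // yb (negbTE yc).
- by exists z; rewrite row // ea // (negbTE zb) zc.
- by exists u; rewrite row // ea // (negbTE ub) (negbTE uc).
- by exists w; rewrite !inE ![w == _]eq_sym !negb_or aw bw cw (negbTE nwa) wb wc.
- exists a'; rewrite !inE ![a' == _]eq_sym !negb_or n1 ba' ca' (negbTE (fam_nadj a'J aJ)) a'b.
  by rewrite (negbTE (fam_dis a''J a'J _ cT)) // eq_sym.
- exists a''; rewrite !inE ![a'' == _]eq_sym !negb_or n2 ba'' ca''.
  by rewrite (negbTE (fam_nadj a''J aJ)) a''c (negbTE (fam_dis a'J a''J _ bT)).
by exists v; rewrite nv (negbTE va) (negbTE vb) (negbTE vc).
Qed.

Lemma fam_no_triangle a a' a'' x x' y y' z z' : a \in J -> a' \in J -> a'' \in J ->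
  a != a' -> a != a'' -> a' != a'' ->
  x \in T a -> x' \in T a -> x != x' -> ~~ e x x' ->
  y \in T a' -> y' \in T a' -> y != y' -> ~~ e y y' ->
  z \in T a'' -> z' \in T a'' -> z != z' -> ~~ e z z' ->
  {in [:: x; x'] & [:: y; y'], forall u v, e u v} ->
  {in [:: x; x'] & [:: z; z'], forall u v, e u v} ->
  {in [:: y; y'] & [:: z; z'], forall u v, e u v} -> False.
Proof.
move=> aJ a'J a''J n1 n2 n3 xT x'T nx ex yT y'T ny ey zT z'T nz ez hxy hxz hyz.
have [xV wx ax] := famE aJ xT; have [yV wy ay] := famE a'J yT; have [zV wz az] := famE a''J zT.
have neq u v : e u v -> u != v by move=> euv; apply/eqP => E; rewrite E irr in euv.
have exy : e x y by apply: hxy; rewrite !inE eqxx.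
have ex'y : e x' y by apply: hxy; rewrite !inE eqxx ?orbT.
have exy' : e x y' by apply: hxy; rewrite !inE eqxx ?orbT.
have exz : e x z by apply: hxz; rewrite !inE eqxx.
have ex'z : e x' z by apply: hxz; rewrite !inE eqxx ?orbT.
have exz' : e x z' by apply: hxz; rewrite !inE eqxx ?orbT.
have eyz : e y z by apply: hyz; rewrite !inE eqxx.
have ey'z : e y' z by apply: hyz; rewrite !inE eqxx ?orbT.
have eyz' : e y z' by apply: hyz; rewrite !inE eqxx ?orbT.
have arow b : b \in J -> b \notin [:: x; y; z].
  move=> bJ; rewrite !inE ![b == _]eq_sym !negb_or.
  have /andP[-> _] := fam_neq aJ bJ xT; have /andP[-> _] := fam_neq a'J bJ yT.
  by have /andP[-> _] := fam_neq a''J bJ zT.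
have [v [nv va vb vc]] := far xV yV zV.
case: (hVC (x := x) (y := y) (z := z)); split.
  by rewrite /= !inE negb_or !neq.
(* [w] sees all three columns. Each of [x'], [y'], [z'] misses exactly its own non-neighbour among
   them, each centre sees only the column in its own tooth, and [v] sees none. *)
move=> [] [] [].
- exists w; rewrite wx wy wz !inE !negb_or ![w == _]eq_sym.
  by have /andP[_ ->] := fam_neq aJ aJ xT; have /andP[_ ->] := fam_neq a'J aJ yT;
     have /andP[_ ->] := fam_neq a''J aJ zT.
- exists z'; rewrite ![e z' _]sym exz' eyz' (negbTE ez) !inE !negb_or ![z' == _]eq_sym.
  by rewrite nz !neq.
- by exists y'; rewrite ey'z ![e y' _]sym exy' (negbTE ey) !inE !negb_or ![y' == _]eq_sym ny !neq //
    sym.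
- exists a; rewrite arow // ax (negbTE (fam_dis a'J aJ _ yT)) 1?eq_sym //.
  by rewrite (negbTE (fam_dis a''J aJ _ zT)) // eq_sym.
- by exists x'; rewrite ex'y ex'z sym (negbTE ex) !inE !negb_or [x' == _]eq_sym nx !neq.
- exists a'; rewrite arow // ay (negbTE (fam_dis aJ a'J _ xT)) //.
  by rewrite (negbTE (fam_dis a''J a'J _ zT)) // eq_sym.
- exists a''; rewrite arow // az (negbTE (fam_dis aJ a''J _ xT)) //.
  by rewrite (negbTE (fam_dis a'J a''J _ yT)).
by exists v; rewrite nv (negbTE va) (negbTE vb) (negbTE vc).
Qed.

End Family.

(** * Anticomplete blocks in a comb *)

Lemma card_bigcup_dis (I V : finType) (K : {set I}) (F : I -> {set V}) :
  {in K &, forall a b, a != b -> [disjoint F a & F b]} ->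
  #|\bigcup_(a in K) F a| = \sum_(a in K) #|F a|.
Proof.
move=> dF; under [RHS]eq_bigr do rewrite -sum1_card.
rewrite (exchange_big_dep [in \bigcup_(a in K) F a]) /=; last first.
  by move=> a x aK xa; apply/bigcupP; exists a.
rewrite -sum1_card; apply: eq_bigr => x /bigcupP[a aK xa].
rewrite (bigD1 a) /= ?aK //= big_pred0 // => b.
apply/negbTE/negP => /andP[/andP[bK xb] nba].
by have := disjointFr (dF b a bK aK nba) xb; rewrite xa.
Qed.

(** The colour is the index modulo [q]; inside a class the quotient by [q] is injective. It supplies
    the groups of centres required by [tri_lemma]. *)
Lemma balanced_coloring (V : finType) (J : {set V}) (q : nat) : 0 < q ->
  exists g : V -> 'I_q, forall z, q * #|[set a in J | g a == z]| <= #|J| + q.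
Proof.
move=> q0; pose ix a := index a (enum J).
exists (fun a => Ordinal (ltn_pmod (ix a) q0)) => z.
suff h : #|[set a in J | Ordinal (ltn_pmod (ix a) q0) == z]| <= (#|J| %/ q).+1.
  by apply: leq_trans (leq_mul (leqnn q) h) _; rewrite mulnS addnC leq_add2r mulnC leq_divM.
rewrite -[X in _ <= X]card_ord.
pose f a : 'I_(#|J| %/ q).+1 := inord (ix a %/ q).
have ixJ a : a \in J -> ix a < #|J| by move=> aJ; rewrite /ix cardE index_mem mem_enum.
rewrite -(@card_in_imset _ _ f).
  exact: max_card.
move=> a b; rewrite !inE => /andP[aJ /eqP/(congr1 val) /= az] /andP[bJ /eqP/(congr1 val) /= bz].
move/(congr1 val); rewrite /f /= !inordK ?ltnS ?leq_div2r ?(ltnW (ixJ _ _)) // => E.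
have : ix a = ix b by rewrite (divn_eq (ix a) q) (divn_eq (ix b) q) E az bz.
by apply: (@index_inj _ a) => //; rewrite mem_enum.
Qed.

Lemma crossS (V : finType) (T T' A B : {set V}) : T' \subset T ->
  cross T (A :&: T) (B :&: T) -> cross T' (A :&: T') (B :&: T').
Proof.
move=> T'T.
have E (X : {set V}) : X :&: T' = (X :&: T) :&: T' by rewrite -setIA (setIidPr T'T).
rewrite (E A) (E B) /cross /laminar; move: (A :&: T) (B :&: T) => {E} X Y.
case/orP=> [/or3P[dXY|XY|YX]|cov].
- by apply/orP; left; apply/or3P/Or31; apply: disjointWl (subsetIl _ _) (disjointWr (subsetIl _ _) dXY).
- by apply/orP; left; apply/or3P/Or32; apply: setSI.
- by apply/orP; left; apply/or3P/Or33; apply: setSI.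
by apply/orP; right; rewrite -setIUl subsetI (subset_trans T'T cov) subxx.
Qed.

Section Sequential.

Variables (V : finType) (e : rel V).
Hypotheses (sym : symmetric e) (irr : irreflexive e) (hVC : no_shatter3 e).
Variables (V0 : {set V}) (w : V).
Hypothesis far : {in V0 & &, forall x y z,
  exists u, [/\ u \notin [:: x; y; z], ~~ e u x, ~~ e u y & ~~ e u z]}.
Variables (J : {set V}) (T : V -> {set V}) (t : nat).
Hypothesis fam : comb_fam e V0 w J T t.

Definition fam_step (q : nat) : Prop :=
  exists (a : V) (X C : {set V}), [/\ a \in J, X \subset T a, t <= 8 * q ^ 2 * #|X|,
    C \subset \bigcup_(b in J :\ a) T b /\ {in C & X, forall c x, e c x} &
    #|J| * t <= 16 * q ^ 3 * #|C|].

(** The state after choosing [r] blocks: [U] collects the centres whose teeth are used up, and [E]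
    the spoiled vertices, those that may be adjacent to a chosen block. *)
Definition fam_blocks (q r : nat) (Rs : seq {set V}) (U E : {set V}) : Prop :=
  [/\ size Rs = r, pairwise (sep e) Rs,
    {in Rs, forall R : {set V}, R \subset \bigcup_(a in U) T a /\ t <= 8 * q ^ 2 * #|R|},
    [/\ U \subset J, #|U| <= r & q * #|E| <= 15 * r * #|J| * t] &
    {in J :\: U, forall a, {in Rs, forall R : {set V}, {in T a :\: E & R, forall c x, ~~ e c x}}}].

Lemma teeth_disjoint : {in J &, forall a b, a != b -> [disjoint T a & T b]}.
Proof.
move=> a b aJ bJ nab; rewrite -setI_eq0; apply/eqP/setP => x; rewrite !inE.
apply/negP => /andP[xa xb]; have := fam_tooth_neq fam aJ bJ nab xa xb.
by rewrite eqxx.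
Qed.

Lemma card_tooth a : a \in J -> #|T a| = t.
Proof. by case: fam => _ _ _ h _ /h[]. Qed.

Lemma card_teeth (K : {set V}) : K \subset J -> #|\bigcup_(a in K) T a| = #|K| * t.
Proof.
move=> /subsetP KJ; rewrite card_bigcup_dis.
  by rewrite -sum_nat_const; apply: eq_bigr => a /KJ/card_tooth.
by move=> a b /KJ aJ /KJ bJ; apply: teeth_disjoint.
Qed.

Lemma fam_blocksP (q r : nat) : 60 * r <= q -> 0 < q -> 0 < t -> 8 * q ^ 3 <= #|J| ->
  fam_step q \/ exists Rs U E, fam_blocks q r Rs U E.
Proof.
move=> rq q0 t0 kq; elim: r rq => [|r IH] rq.
  right; exists [::], set0, set0; split=> //.
  by rewrite !cards0 sub0set !muln0.
have [|//|[Rs [U [E [sRs pRs hRs [UJ cU cE] sepE]]]]] := IH; [by lia|by left|].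
have q8 : 60 <= q by lia.
have kbig : 4 * r.+1 <= #|J|.
  apply: leq_trans kq; rewrite !expnS expn0 muln1.
  have : q * 1 <= q * (q * q) by rewrite leq_mul2l muln_gt0 q0 orbT.
  lia.
have cE' : 4 * #|E| <= #|J| * t.
  rewrite -(leq_pmul2l q0); have : 60 * r * (#|J| * t) <= q * (#|J| * t).
    by rewrite leq_mul2r; apply/orP; right; lia.
  lia.
have disE (a b : V) : a \in J -> b \in J -> a != b -> [disjoint T a :&: E & T b :&: E].
  move=> aJ bJ nab; apply: disjointWl (subsetIl _ _) (disjointWr (subsetIl _ _) _).
  exact: teeth_disjoint.
have cJU : #|J :\: U| + #|U| = #|J| by rewrite cardsD (setIidPr UJ) subnK // subset_leq_card.
have [a /andP[aJU ha]] : exists a, (a \in J :\: U) && (2 * #|T a :&: E| <= t).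
  apply/existsP; apply: contraT => /existsPn hn.
  have h1 : \sum_(a in J :\: U) #|T a :&: E| <= #|E|.
    rewrite -card_bigcup_dis; first by apply/subset_leq_card/bigcupsP => a _; apply: subsetIr.
    by move=> a b /setDP[aJ _] /setDP[bJ _]; apply: disE.
  have : \sum_(a in J :\: U) t <= \sum_(a in J :\: U) 2 * #|T a :&: E|.
    by apply: leq_sum => a aJU; move: (hn a); rewrite aJU /= -ltnNge => /ltnW.
  rewrite sum_nat_const -big_distrr /= => h2.
  have h3 : 4 * (#|J :\: U| * t) <= 2 * (#|J| * t) by lia.
  have : 4 * #|J :\: U| <= 2 * #|J| by rewrite -(leq_pmul2r t0) -!mulnA.
  by lia.
have [aJ aU] := setDP aJU.
pose T' := T a :\: E; pose K := (J :\: U) :\ a; pose C := (\bigcup_(b in K) T b) :\: E.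
have KJ : K \subset J by apply/subsetP => b /setD1P[_ /setDP[]].
have hT' : t <= 2 * #|T'|.
  by have := cardsID E (T a); rewrite card_tooth // -/T'; lia.
have hC : #|J| * t <= 2 * #|C|.
  have h1 : #|K| * t <= #|E| + #|C|.
    rewrite -card_teeth // -(cardsID E) leq_add2r; exact/subset_leq_card/subsetIr.
  have h2 : #|K|.+1 = #|J :\: U| by rewrite [RHS](cardsD1 a) aJU.
  have h3 : 4 * (r.+1 * t) <= #|J| * t by rewrite mulnA leq_mul2r kbig orbT.
  have h4 : #|J| * t <= #|K| * t + r.+1 * t by rewrite -mulnDl leq_mul2r; apply/orP; right; lia.
  by lia.
pose col c := odflt w [pick b in J | c \in T b].
have colP b c : b \in J -> c \in T b -> col c = b.
  move=> bJ cb; rewrite /col; case: pickP => [b' /andP[b'J cb']|/(_ b)]; last by rewrite bJ cb.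
  by apply/eqP; apply: contraT => nb; have := fam_tooth_neq fam b'J bJ nb cb' cb; rewrite eqxx.
have CP c : c \in C -> [/\ col c \in K, c \in T (col c) & c \notin E].
  by case/setDP=> /bigcupP[b bK cb] nc; rewrite (colP b) // (subsetP KJ).
have KP b : b \in K -> [/\ b \in J, b \notin U & a != b].
  by rewrite !inE eq_sym => /and3P[-> -> ->].
have [g hg] := balanced_coloring J q0.
pose S c := nb e c :&: T'; pose grp c := g (col c).
have kt0 : 0 < #|J| * t by rewrite muln_gt0 t0; lia.
have q3 : q <= q ^ 3 by rewrite !expnS expn0 muln1 leq_pmulr // muln_gt0 q0.
have q3t : 8 * q ^ 3 * t <= #|J| * t by rewrite leq_mul2r kq orbT.
have [|||||||||[R [RT hR hCR]]|[X [XT hX hCX]]] :=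
  @tri_lemma V V V C T' S col q t grp.
- by lia.
- by rewrite -card_gt0; lia.
- by rewrite -card_gt0; lia.
- move=> z; have [zJ|zJ] := boolP (z \in J).
    rewrite -[leqRHS](card_tooth zJ); apply/subset_leq_card/subsetP => c.
    by rewrite inE => /andP[/CP[_ cc _] /eqP <-].
  rewrite (_ : [set _ in _ | _] = set0) ?cards0 //; apply/setP => c; rewrite inE in_set0.
  apply/negP => /andP[/CP[cK _ _] /eqP zE]; move: zJ; rewrite -zE.
  by rewrite (subsetP KJ).
- by lia.
- move=> z; have sub : [set c in C | grp c == z] \subset \bigcup_(b in [set b in J | g b == z]) T b.
    apply/subsetP => c; rewrite inE => /andP[/CP[cK cc _] gc].
    by apply/bigcupP; exists (col c); rewrite // inE (subsetP KJ).
  have := subset_leq_card sub; rewrite card_teeth; last by apply/subsetP => b; rewrite inE => /andP[].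
  move=> h1; have := leq_mul (leqnn q) h1; have := leq_mul (hg z) (leqnn t).
  have : q * t <= #|J| * t by rewrite leq_mul2r; apply/orP; right; lia.
  by lia.
- by move=> b c; apply: contra => /eqP; rewrite /grp => ->.
- move=> b c /CP[/KP[bJ _ nb] bb _] /CP[/KP[cJ _ nc] cc _] ncol.
  apply: (@crossS _ (T a)); first exact: subsetDl.
  by apply: (fam_cross sym irr hVC far fam aJ bJ cJ).
- by move=> c _; apply: subsetIr.
- right; exists (R :: Rs), (a |: U), (E :|: [set c in C | ~~ [disjoint S c & R]]).
  have RTa : R \subset T a by apply: subset_trans RT (subsetDl _ _).
  split.
  + by rewrite /= sRs.
  + rewrite /= pRs andbT; apply/allP => Q QRs; apply/sepP.
    have [QU _] := hRs Q QRs; split.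
      rewrite -setI_eq0; apply/eqP/setP => x; rewrite !inE; apply/negP => /andP[xR].
      move/(subsetP QU)/bigcupP => [b bU xb].
      have nab : a != b by apply: contraNneq aU => ->.
      have := fam_tooth_neq fam aJ (subsetP UJ b bU) nab (subsetP RTa x xR) xb.
      by rewrite eqxx.
    by move=> x y xR yQ; apply: (sepE a aJU Q QRs) => //; apply: (subsetP RT).
  + move=> Q; rewrite inE => /predU1P[->|/hRs[QU tQ]].
      split; first by apply: subset_trans RTa _; apply: bigcup_sup; rewrite setU11.
      by lia.
    split=> //; apply: subset_trans QU _; apply/bigcupsP => b bU; apply: bigcup_sup.
    by rewrite setU1r.
  + split; first by rewrite subUset sub1set aJ.
      by rewrite cardsU1 aU; lia.
    have h1 := card_setU_leq E [set c in C | ~~ [disjoint S c & R]].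
    have h2 : #|C| <= #|J| * t.
      rewrite -card_teeth //; apply: subset_leq_card; apply: subset_trans (subsetDl _ _) _.
      by apply/bigcupsP => b /KP[bJ _ _]; apply: bigcup_sup.
    have := leq_mul (leqnn q) h1; lia.
  move=> b; rewrite !inE negb_or => /andP[/andP[nab nbU] bJ] Q.
  rewrite inE => /predU1P[->|QRs] c x; last first.
    rewrite !inE negb_or => /andP[/andP[ncE _] cT]; move=> xQ.
    by apply: (sepE b _ Q QRs); rewrite ?inE ?nbU ?ncE.
  rewrite inE in_setU negb_or => /andP[/andP[ncE nc] cT] xR.
  have cC : c \in C.
    by rewrite inE ncE /=; apply/bigcupP; exists b; rewrite // !inE nab nbU.
  move: nc; rewrite inE cC /= negbK => /disjointFl/(_ xR).
  by rewrite in_setI (subsetP RT x xR) andbT inE => ->.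
left; exists a, X, [set c in C | X \subset S c]; split=> //.
- by apply: subset_trans XT (subsetDl _ _).
- by lia.
- split.
    apply/subsetP => c; rewrite inE => /andP[/CP[cK cc _] _].
    apply/bigcupP; exists (col c) => //; have [bJ _ nab] := KP _ cK.
    by rewrite !inE eq_sym nab.
  by move=> c x; rewrite inE => /andP[_ /subsetP sub] /sub; rewrite !inE => /andP[].
by lia.
Qed.

End Sequential.

(** * Nested combs *)

Section Levels.

Variables (V : finType) (e : rel V).
Hypotheses (sym : symmetric e) (irr : irreflexive e) (hVC : no_shatter3 e).
Variables (V0 : {set V}) (w : V).
Hypothesis far : {in V0 & &, forall x y z,
  exists u, [/\ u \notin [:: x; y; z], ~~ e u x, ~~ e u y & ~~ e u z]}.

(** Keep the centres whose teeth meet [C] in at least [t / d] points, rounded up to [t'], and cut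
    these parts to equal size. On average [C] fills at least [2 / d] of a tooth; the discarded teeth
    account for at most half of that, so many are kept. *)
Lemma fam_step_next (J : {set V}) (T : V -> {set V}) (t q : nat) :
  comb_fam e V0 w J T t -> 0 < q -> 0 < t -> fam_step e J T t q ->
  exists (a : V) (X J' : {set V}) (T' : V -> {set V}) (t' : nat),
    [/\ [/\ a \in J, X \subset T a & t <= (2 * q) ^ 3 * #|X|],
        [/\ comb_fam e V0 w J' T' t', 0 < t', #|J| <= (2 * q) ^ 5 * #|J'| & t <= (2 * q) ^ 5 * t'],
        J' \subset J :\ a,
        {in J', forall b, T' b \subset T b} &
        {in J', forall b, {in X & T' b, forall x y, e x y}}].
Proof.
move=> fam q0 t0 [a [X [C [aJ XT hX [CT hC] hkt]]]].
have p3 : 8 * q ^ 2 <= (2 * q) ^ 3.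
  by rewrite expnMn leq_mul // leq_pexp2l.
have p5 : 32 * q ^ 3 <= (2 * q) ^ 5.
  by rewrite expnMn leq_mul // leq_pexp2l.
pose d := 32 * q ^ 3; have d0 : 0 < d by rewrite muln_gt0 expn_gt0 q0.
pose t' := (t.-1 %/ d).+1.
pose J' := [set b in J :\ a | t' <= #|T b :&: C|].
have J'J : J' \subset J by apply/subsetP => b; rewrite !inE => /andP[/andP[_ ->]].
pose T' b := odflt set0 [pick U : {set V} | (U \subset T b :&: C) && (#|U| == t')].
have T'P b : b \in J' -> T' b \subset T b :&: C /\ #|T' b| = t'.
  rewrite inE => /andP[_ /subset_of_card[U US cU]].
  rewrite /T'; case: pickP => [W /andP[WT /eqP //]|/(_ U)].
  by rewrite US cU eqxx.
exists a, X, J', T', t'; split=> //.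
- by split=> //; apply: leq_trans hX _; rewrite leq_mul2r p3 orbT.
- case: (fam) => JV sJ hw hT hd; split=> //.
  + split.
    * exact: subset_trans J'J JV.
    * apply/stabP => x y xJ yJ; move/stabP: sJ; apply; exact: (subsetP J'J).
    * by move=> b bJ; apply: hw; apply: (subsetP J'J).
    * move=> b bJ; have [h1 h2] := T'P b bJ; split=> //.
      have [h3 _] := hT b (subsetP J'J b bJ); apply: subset_trans h3.
      exact: subset_trans h1 (subsetIl _ _).
    * move=> b c bJ cJ nbc; have [h1 h2] := T'P b bJ.
      apply: disjointWl (hd b c (subsetP J'J b bJ) (subsetP J'J c cJ) nbc).
      exact: subset_trans h1 (subsetIl _ _).
  + apply: leq_trans (leq_mul p5 (leqnn _)); rewrite -/d.
    have h1 : #|C| <= #|J'| * t + #|J| * (t.-1 %/ d).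
      have -> : #|C| = #|\bigcup_(b in J :\ a) (T b :&: C)|.
        apply: eq_card => x; apply/idP/bigcupP => [xC|[b _ /setIP[]//]].
        by have /bigcupP[b bJ xb] := subsetP CT x xC; exists b; rewrite // inE xb.
      apply: leq_trans (card_bigcup_leq _ _) _.
      rewrite (bigID (fun b => t' <= #|T b :&: C|)) /=; apply: leq_add.
        rewrite -sum_nat_const; rewrite [X in _ <= X](eq_bigl (fun b => (b \in J :\ a) && (t' <= #|T b :&: C|))).
          apply: leq_sum => b /andP[/setD1P[_ bJ] _]; rewrite -(card_tooth fam bJ).
          exact/subset_leq_card/subsetIl.
        by move=> b; rewrite !inE.
      rewrite -sum_nat_const.
      apply: (@leq_trans (\sum_(b in J :\ a) t.-1 %/ d)).
        rewrite [X in _ <= X](bigID (fun b => t' <= #|T b :&: C|)) /= addnC.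
        apply: leq_trans (leq_addr _ _); apply: leq_sum => b /andP[_].
        by rewrite -ltnNge.
      by rewrite !sum_nat_const leq_mul2r; apply/orP; right; apply/subset_leq_card/subsetDl.
    have h2 : d * (t.-1 %/ d) <= t by rewrite mulnC; apply: leq_trans (leq_divM _ _) _; lia.
    have h3 : #|J| * (d * (t.-1 %/ d)) <= #|J| * t by rewrite leq_mul2l h2 orbT.
    have h4 : d * #|C| <= d * (#|J'| * t + #|J| * (t.-1 %/ d)) by rewrite leq_mul2l h1 orbT.
    rewrite -(leq_pmul2r t0); have dE : d * #|C| = 2 * (16 * q ^ 3 * #|C|) by rewrite /d; lia.
    lia.
  apply: leq_trans (leq_mul p5 (leqnn _)); rewrite -/d /t' mulnC.
  by have := ltn_ceil t.-1 d0; lia.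
- by apply/subsetP => b; rewrite inE => /andP[].
- by move=> b bJ; have [h1 _] := T'P b bJ; apply: subset_trans h1 (subsetIl _ _).
move=> b bJ x y xX yT; rewrite sym; apply: hC => //.
by have [h1 _] := T'P b bJ; have := subsetP h1 y yT; rewrite inE => /andP[].
Qed.

(** Three successive steps would leave pieces [X1], [X2], [X3] of distinct teeth, pairwise complete.
    If all exceed the clique number, each holds a non-adjacent pair, against [fam_no_triangle]. The
    exponent is [13 = 5 + 5 + 3]: two passages to a smaller comb, then one piece of a tooth. *)
Lemma fam_dichotomy (J : {set V}) (T : V -> {set V}) (t q r : nat) :
  comb_fam e V0 w J T t -> 60 * r <= q -> 0 < q -> 0 < t -> (2 * q) ^ 13 <= #|J| ->
  t <= (2 * q) ^ 13 * alpha (compl_rel e) V0 \/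
  exists Rs : seq {set V}, [/\ size Rs = r, pairwise (sep e) Rs &
    {in Rs, forall R : {set V}, R \subset V0 /\ t <= (2 * q) ^ 13 * #|R|}].
Proof.
move=> fam rq q0 t0 hJ; set om := alpha _ _; pose p := 2 * q.
have p0 : 0 < p by rewrite muln_gt0.
have p3 : 8 * q ^ 3 = p ^ 3 by rewrite expnMn.
have pw m c x : m <= 13 -> c <= p ^ m * x -> c <= p ^ 13 * x.
  by move=> h /leq_trans; apply; rewrite leq_mul2r leq_pexp2l ?orbT.
have p32 : 8 * q ^ 2 <= p ^ 3.
  by rewrite expnMn leq_mul // leq_pexp2l.
have blocksP (J' : {set V}) T' t' m : comb_fam e V0 w J' T' t' -> m <= 10 -> t <= p ^ m * t' ->
    (exists Rs U E, fam_blocks e J' T' t' q r Rs U E) ->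
    exists Rs : seq {set V}, [/\ size Rs = r, pairwise (sep e) Rs &
    {in Rs, forall R : {set V}, R \subset V0 /\ t <= p ^ 13 * #|R|}].
  move=> fam' m10 tt' [Rs [U [E [sRs pRs hRs [/subsetP UJ _ _] _]]]]; exists Rs; split=> // R RRs.
  have [RU hR] := hRs R RRs; split.
    apply: subset_trans RU _; apply/bigcupsP => b /UJ bJ; apply/subsetP => x.
    by case/(famE fam' bJ).
  apply: (pw (m + 3)); first by lia.
  apply: leq_trans tt' _; rewrite expnD -mulnA leq_mul2l; apply/orP; right.
  by apply: leq_trans hR _; rewrite leq_mul2r p32 orbT.
have big (m : nat) (J' : {set V}) : m <= 10 -> #|J| <= p ^ m * #|J'| -> 8 * q ^ 3 <= #|J'|.
  move=> m10 h; rewrite p3 -(@leq_pmul2l (p ^ m)) ?expn_gt0 ?p0 //.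
  by apply: leq_trans h; apply: leq_trans hJ; rewrite -expnD leq_pexp2l //; lia.
have next m x c y : x <= p ^ m * c -> c <= p ^ 5 * y -> x <= p ^ (m + 5) * y.
  by move=> h1 h2; apply: leq_trans h1 _; rewrite expnD -mulnA leq_mul2l h2 orbT.
have [st1|bl] := @fam_blocksP V e sym irr hVC V0 w far J T t fam q r rq q0 t0
  (big 0 J isT (eq_leq (esym (mul1n _)))); last first.
  by right; apply: (blocksP J T t 0) bl => //; rewrite mul1n.
have [a1 [X1 [J1 [T1 [t1 [[a1J X1T hX1] [fam1 t10 cJ1 ct1] J1J T1T c1]]]]]] :=
  fam_step_next fam q0 t0 st1.
have [st2|bl] := @fam_blocksP V e sym irr hVC V0 w far J1 T1 t1 fam1 q r rq q0 t10
  (big 5 J1 isT cJ1); last first.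
  by right; apply: (blocksP J1 T1 t1 5) bl.
have [a2 [X2 [J2 [T2 [t2 [[a2J X2T hX2] [fam2 t20 cJ2 ct2] J2J T2T c2]]]]]] :=
  fam_step_next fam1 q0 t10 st2.
have cJ2' := next 5 _ _ _ cJ1 cJ2; have ct2' := next 5 _ _ _ ct1 ct2.
have [st3|bl] := @fam_blocksP V e sym irr hVC V0 w far J2 T2 t2 fam2 q r rq q0 t20
  (big 10 J2 isT cJ2'); last first.
  by right; apply: (blocksP J2 T2 t2 10) bl.
have [a3 [X3 [J3 [T3 [t3 [[a3J X3T hX3] _ _ _ _]]]]]] := fam_step_next fam2 q0 t20 st3.
left; rewrite leqNgt; apply/negP => hom.
have [a2J0 n12] : a2 \in J /\ a1 != a2.
  by move/subsetP: J1J => /(_ a2 a2J); rewrite !inE eq_sym => /andP[-> ->].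
have [a3J1 n23] : a3 \in J1 /\ a2 != a3.
  by move/subsetP: J2J => /(_ a3 a3J); rewrite !inE eq_sym => /andP[-> ->].
have [a3J0 n13] : a3 \in J /\ a1 != a3.
  by move/subsetP: J1J => /(_ a3 a3J1); rewrite !inE eq_sym => /andP[-> ->].
have pair m (X : {set V}) (c : V) : m <= 13 -> t <= p ^ m * #|X| -> c \in J -> X \subset T c ->
    exists x y, [/\ x \in X, y \in X, x != y & ~~ e x y].
  move=> m13 h cJ XTc; apply: (@nonadjacent_pair _ _ X V0).
    by apply/subsetP => x /(subsetP XTc) /(famE fam cJ)[].
  rewrite -(@ltn_pmul2l (p ^ 13)) ?expn_gt0 ?p0 //; apply: leq_trans hom _.
  exact: pw h.
have mulx m x (y z : nat) : x <= p ^ m * y -> y <= p ^ 3 * z -> x <= p ^ (m + 3) * z.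
  by move=> h1 h2; apply: leq_trans h1 _; rewrite expnD -mulnA leq_mul2l h2 orbT.
have X2T0 := subset_trans X2T (T1T a2 a2J).
have X3T1 := subset_trans X3T (T2T a3 a3J).
have X3T0 := subset_trans X3T1 (T1T a3 a3J1).
have [x [x' [xX x'X nx ex]]] := pair 3 X1 a1 isT hX1 a1J X1T.
have [y [y' [yX y'X ny ey]]] := pair 8 X2 a2 isT (mulx 5 _ _ _ ct1 hX2) a2J0 X2T0.
have [z [z' [zX z'X nz ez]]] := pair 13 X3 a3 isT (mulx 10 _ _ _ ct2' hX3) a3J0 X3T0.
have in2 (X : {set V}) b b' : b \in X -> b' \in X -> {subset [:: b; b'] <= X}.
  by move=> bX b'X c; rewrite !inE => /orP[]/eqP->.
apply: (fam_no_triangle sym irr hVC far fam a1J a2J0 a3J0 n12 n13 n23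
  (subsetP X1T x xX) (subsetP X1T x' x'X) nx ex
  (subsetP X2T0 y yX) (subsetP X2T0 y' y'X) ny ey
  (subsetP X3T0 z zX) (subsetP X3T0 z' z'X) nz ez).
- move=> u v /(in2 _ _ _ xX x'X) uX /(in2 _ _ _ yX y'X) vX.
  by apply: (c1 a2 a2J) => //; apply: (subsetP X2T).
- move=> u v /(in2 _ _ _ xX x'X) uX /(in2 _ _ _ zX z'X) vX.
  by apply: (c1 a3 a3J1) => //; apply: (subsetP X3T1).
move=> u v /(in2 _ _ _ yX y'X) uX /(in2 _ _ _ zX z'X) vX.
by apply: (c2 a3 a3J) => //; apply: (subsetP X3T).
Qed.

End Levels.

(** * Critical sparse sets *)

Section Core.

Variables (V : finType) (e : rel V).
Hypotheses (sym : symmetric e) (irr : irreflexive e) (hVC : no_shatter3 e).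

Lemma edge_count (A B : {set V}) :
  \sum_(a in A) #|nb e a :&: B| = \sum_(b in B) #|nb e b :&: A|.
Proof.
have E (X Y : {set V}) : \sum_(a in X) #|nb e a :&: Y| = \sum_(a in X) \sum_(b in Y | e a b) 1.
  apply: eq_bigr => a _; rewrite -sum1_card; apply: eq_bigl => b.
  by rewrite !inE andbC.
rewrite !E (exchange_big_dep [in B]) /=; last by move=> a b _ /andP[].
by apply: eq_bigr => b bB; apply: eq_bigl => a; rewrite bB sym.
Qed.

Variable (V0 : {set V}).
Let n := #|V0|.
Let al := alpha e V0.

Lemma critical_structure (u M : nat) : 2 <= u -> 2 * 36 ^ u < M ->
  {in V0, forall v, M * #|nb e v :&: V0| <= n} ->
  (forall X : {set V}, X \subset V0 -> al ^ (2 * u) * #|X| <= alpha e X ^ (2 * u) * n) ->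
  n <= al \/ exists (w : V) (J : {set V}) (T : V -> {set V}) (t : nat),
    [/\ {in V0 & &, forall x y z, exists v, [/\ v \notin [:: x; y; z], ~~ e v x, ~~ e v y & ~~ e v z]},
        comb_fam e V0 w J T t, 0 < t, n <= (72 * #|J|) ^ 3 * t & M <= (36 * #|J|) ^ 2].
Proof.
move=> u2 hM hdeg crit; pose deg v := #|nb e v :&: V0|.
have [V00|/set0Pn[w0 w0V]] := eqVneq V0 set0; first by left; rewrite /n V00 cards0.
have n0 : 0 < n by apply/card_gt0P; exists w0.
have al0 : 0 < al by apply: alpha_gt0 => //; apply/set0Pn; exists w0.
have [w wV maxw] := @arg_maxnP _ w0 (fun v => v \in V0) deg w0V.
set D := deg w in maxw.
have {}maxw v : v \in V0 -> deg v <= D := maxw v.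
have [D0|Dgt0] := posnP D.
  left; apply: leq_alpha; rewrite ?subxx //; apply/stabP => x y xV yV.
  have := maxw x xV; rewrite D0 leqn0 => /eqP/cards0_eq/setP/(_ y).
  by rewrite !inE yV andbT => ->.
right.
have hMD : M * D <= n := hdeg w wV.
have M1296 : 2 * 36 < M.
  apply: leq_ltn_trans hM; rewrite leq_mul2l /= -{1}(expn1 36) leq_pexp2l //; lia.
(* Three closed neighbourhoods have at most [3 * (D + 1) <= 6 * D] vertices in [V0], fewer than
   [n]. *)
have far : {in V0 & &, forall x y z,
    exists v, [/\ v \notin [:: x; y; z], ~~ e v x, ~~ e v y & ~~ e v z]}.
  move=> x y z xV yV zV.
  pose Bad v := v |: (nb e v :&: V0).
  have cBad v : v \in V0 -> #|Bad v| <= D.+1.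
    by move=> vV; rewrite cardsU1 -add1n leq_add ?leq_b1 // maxw.
  have : ~~ (V0 \subset Bad x :|: (Bad y :|: Bad z)).
    apply/negP => /subset_leq_card h; have := card_setU_leq (Bad x) (Bad y :|: Bad z).
    have := card_setU_leq (Bad y) (Bad z); have := cBad x xV; have := cBad y yV.
    have := cBad z zV; rewrite -/n in h; have : 7 * D <= M * D by rewrite leq_mul2r; apply/orP; right; lia.
    by lia.
  case/subsetPn => v vV; rewrite !inE vV !andbT !negb_or.
  case/and3P => /andP[n1 ?] /andP[n2 ?] /andP[n3 ?]; exists v.
  by rewrite ![e v _]sym !inE !negb_or n1 n2 n3.
(* [L] is the square root of [n / D], rounded up. *)
have [L minL] : exists L, n <= L ^ 2 * D /\ forall L', n <= L' ^ 2 * D -> L <= L'.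
  have ex : exists L, n <= L ^ 2 * D by exists n; nia.
  by case: (ex_minnP ex) => L h1 h2; exists L.
case: minL => hL minL.
have L2 : 1 < L.
  rewrite ltnNge; apply/negP => L1.
  have : L ^ 2 * D <= D by rewrite -[leqRHS]mul1n leq_mul2r; apply/orP; right; case: (L) L1 => [|[]].
  have : 2 * D <= M * D by rewrite leq_mul2r; apply/orP; right; lia.
  by lia.
have hL4 : L ^ 2 * D <= 4 * n.
  have : ~~ (n <= L.-1 ^ 2 * D) by apply/negP => /minL; lia.
  by rewrite -ltnNge => h; case: (L) L2 h => [|[|l]] //= _; rewrite -!mulnn; nia.
have hLM : M <= L ^ 2 by rewrite -(leq_pmul2r Dgt0); apply: leq_trans hMD hL.
pose N := nb e w :&: V0; have cN : #|N| = D by [].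
have NV : N \subset V0 by apply: subsetIr.
(* Counting edges to [N] shows that few vertices have more than [D / L] neighbours there; without
   them, the degree bound of [comb_lemma] holds. *)
pose Abig := [set a in V0 :\: N | D < L * #|nb e a :&: N|].
have cAbig : #|Abig| <= L * D.
  rewrite -(leq_pmul2r Dgt0).
  have h1 : #|Abig| * D <= \sum_(a in V0) L * #|nb e a :&: N|.
    rewrite -sum_nat_const; apply: (@leq_trans (\sum_(a in Abig) L * #|nb e a :&: N|)).
      by apply: leq_sum => a; rewrite inE => /andP[_ /ltnW].
    rewrite [X in _ <= X](big_setID Abig) /= (setIidPr _); first exact: leq_addr.
    by apply/subsetP => a; rewrite !inE => /andP[/andP[_ ->]].
  apply: leq_trans h1 _; rewrite -big_distrr /= edge_count -mulnA leq_mul2l.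
  apply/orP; right; rewrite -{1}cN -sum_nat_const; apply: leq_sum => b bN.
  by apply: maxw; apply: (subsetP NV).
pose A0 := V0 :\: (N :|: (w |: Abig)).
have A0V : A0 \subset V0 by apply: subsetDl.
have cA0 : n <= #|A0| + 3 * L * D.
  have h1 : n <= #|A0| + #|N :|: (w |: Abig)|.
    by rewrite /n -(cardsID (N :|: (w |: Abig)) V0) addnC leq_add2l; apply/subset_leq_card/subsetIr.
  have h2 := card_setU_leq N (w |: Abig); have h3 := card_setU_leq [set w] Abig.
  rewrite cards1 in h3.
  have : 2 * D <= L * D by rewrite leq_mul2r L2 orbT.
  lia.
have [A [AA0 sA cA]] := alphaP e A0.
have AV := subset_trans AA0 A0V.
(* [A0] misses at most [3 * L * D] vertices, so by criticality [A] is nearly as large as [al]. *)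
have hA : al * n <= #|A| * n + 3 * L * D * al.
  have h1 := crit A0 A0V; rewrite -cA in h1.
  have Aal : #|A| <= al by apply: leq_alpha.
  have h2 : al ^ (2 * u) * #|A0| <= #|A| * al ^ (2 * u).-1 * n.
    apply: leq_trans h1 _; rewrite leq_mul2r; apply/orP; right.
    rewrite -{1}(prednK (_ : 0 < 2 * u)); last by lia.
    by rewrite expnS leq_mul2l leq_exp2r ?Aal ?orbT //; lia.
  have h3 : al * #|A0| <= #|A| * n.
    rewrite -(leq_pmul2l (_ : 0 < al ^ (2 * u).-1)) ?expn_gt0 ?al0 //.
    have E : al ^ (2 * u) = al ^ (2 * u).-1 * al.
      by rewrite -{1}(prednK (_ : 0 < 2 * u)) ?expnSr //; lia.
    by rewrite mulnA -E; apply: leq_trans h2 _; rewrite mulnCA mulnA.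
  have := leq_mul (leqnn al) cA0; lia.
(* The part of [N] not dominated by [A] is anticomplete to [A], so its [alpha] is at most the
   deficit [al - #|A|]. *)
pose Bs := [set b in N | [disjoint nb e b & A]].
have BsV : Bs \subset V0 by apply: subset_trans NV; apply/subsetP => b; rewrite inE => /andP[].
have hBs : alpha e Bs + #|A| <= al.
  have -> : #|A| = alpha e A.
    by apply/eqP; rewrite eqn_leq alpha_le_card leq_alpha.
  apply: alpha_sep => //; apply/sepP; split.
    rewrite -setI_eq0; apply/eqP/setP => b; rewrite in_set0; apply/negP => /setIP[].
    rewrite inE => /andP[bN _] /(subsetP AA0); by rewrite in_setD in_setU bN.
  move=> b a; rewrite inE => /andP[_ /disjointFl h] aA; have := h a aA.
  by rewrite inE => ->.
have hBs2 : alpha e Bs ^ 2 * n <= 36 * D * al ^ 2.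
  have h1 : alpha e Bs * n <= 3 * L * D * al.
    by have := leq_mul hBs (leqnn n); lia.
  have h2 := leq_mul h1 h1; rewrite -!mulnn in hL4 *.
  rewrite -(leq_pmul2r n0).
  have h3 : 9 * (L * L * D) * (D * al * al) <= 9 * (4 * n) * (D * al * al).
    by rewrite leq_mul2r leq_mul2l hL4 !orbT.
  lia.
(* Were [Bs] more than half of [N], criticality would give [(n / D) ^ (u - 1) <= 2 * 36 ^ u],
   against [n / D >= M > 2 * 36 ^ u]. *)
have cBs : 2 * #|Bs| <= D.
  rewrite leqNgt; apply/negP => hB.
  have h1 := crit Bs BsV.
  have h2 : al ^ (2 * u) * D <= 2 * (alpha e Bs ^ (2 * u) * n).
    apply: leq_trans (leq_mul (leqnn 2) h1); rewrite mulnCA leq_mul2l; apply/orP; right; exact: ltnW.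
  have h3 : (alpha e Bs ^ 2 * n) ^ u <= (36 * D * al ^ 2) ^ u by rewrite leq_exp2r //; lia.
  rewrite (expnMn (_ ^ 2) n) (expnMn (36 * D) (_ ^ 2)) (expnMn 36 D) -(expnM (alpha e Bs) 2)
    -(expnM al 2) in h3.
  have h4 : al ^ (2 * u) * D * n ^ u <= al ^ (2 * u) * (2 * n * (36 ^ u * D ^ u)).
    apply: leq_trans (leq_mul h2 (leqnn _)) _.
    have := leq_mul (leqnn (2 * n)) h3; lia.
  rewrite -mulnA leq_pmul2l ?expn_gt0 ?al0 // in h4.
  case: u u2 hM h4 {h1 h2 h3 crit hA hBs2} => // u u2 hM h4.
  rewrite !expnS in h4.
  have h5 : n ^ u <= 2 * 36 ^ u.+1 * D ^ u.
    rewrite -(@leq_pmul2l (D * n)) ?muln_gt0 ?Dgt0 // expnS; lia.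
  have h6 : M ^ u * D ^ u <= n ^ u by rewrite -expnMn leq_exp2r.
  have h7 : M ^ u <= 2 * 36 ^ u.+1.
    by rewrite -(@leq_pmul2r (D ^ u)) ?expn_gt0 ?Dgt0 //; apply: leq_trans h6 h5.
  have h8 : M <= M ^ u by rewrite -{1}(expn1 M) leq_pexp2l //; lia.
  by lia.
pose B := N :\: Bs.
have cB : D <= 2 * #|B|.
  have : #|N| <= #|B| + #|Bs|.
    by rewrite -(cardsID Bs N) addnC leq_add2l; apply/subset_leq_card/subsetIr.
  by lia.
have B0 : B != set0 by rewrite -card_gt0; lia.
have [|||K [T [t [KA hT dT hk hkt]]]] := @comb_lemma V V (nb e) A B L _ B0.
- by lia.
- move=> b; rewrite !inE => /andP[+ bN]; rewrite bN /=.
  rewrite -setI_eq0 => /set0Pn[a]; rewrite !inE => /andP[eba aA].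
  by exists a; rewrite ?inE // sym.
- move=> a aA; apply: leq_trans cB.
  have aA0 := subsetP AA0 a aA.
  have : a \notin Abig.
    by move: aA0; rewrite inE in_setU in_setU1 !negb_or => /andP[/and3P[_ _ ->]].
  rewrite inE negb_and -leqNgt => /orP[|h].
    by move: aA0; rewrite !in_setD in_setU negb_or => /andP[/andP[-> _] ->].
  by apply: leq_trans h; rewrite leq_mul2l; apply/orP; right; apply/subset_leq_card/setIS/subsetDl.
have cB0 : 0 < #|B| by rewrite card_gt0.
have t0 : 0 < t.
  rewrite lt0n; apply/eqP => t0; by move: hkt; rewrite t0 muln0 leqNgt muln_gt0 cB0 (ltnW L2).
exists w, K, T, t; split=> //.
- split.
  + exact: subset_trans KA AV.
  + by apply/stabP => x y /(subsetP KA) xA /(subsetP KA) yA; move/stabP: sA; apply.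
  + move=> a /(subsetP KA)/(subsetP AA0).
    rewrite !inE !negb_or => /andP[/and3P[+ -> _] aV]; by rewrite aV andbT.
  + move=> a /hT[sub ct]; split=> //; apply: subset_trans sub _.
    rewrite setIC; apply: setSI; apply: subset_trans (subsetDl _ _) _.
    by rewrite /N setIC.
  + exact: dT.
(* The cube arises from [n <= L * (L * D)], where [L <= 36 * #|K|] and [L * D <= 2 * (#|B| * L) <= 2
   * ((72 * #|K|) ^ 2 * t)]. *)
- apply: leq_trans hL _.
  have h1 : L * (L * D) <= L * (2 * (#|B| * L)) by rewrite leq_mul2l [#|B| * L]mulnC [2 * _]mulnCA leq_mul2l cB !orbT.
  have h2 : L * (2 * (#|B| * L)) <= 36 * #|K| * (2 * ((72 * #|K|) ^ 2 * t)).
    by apply: leq_mul => //; rewrite leq_mul2l.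
  rewrite -mulnn -mulnA; apply: leq_trans h1 (leq_trans h2 _).
  by rewrite !expnS expn0; clear; lia.
by apply: leq_trans hLM _; rewrite leq_exp2r.
Qed.

End Core.

(** * Bounding critical sparse sets *)

Lemma eventually_lt_pow (c m : nat) : exists q0, 60 <= q0 /\
  forall q, q0 <= q -> c * q ^ m < (q %/ 60) ^ m.+2.
Proof.
(* With [r = q %/ 60] one has [q <= 120 * r], and past this threshold a single factor [r] outweighs
   [c * 120 ^ m]. *)
exists (60 * (c * 120 ^ m).+1); split=> [|q hq].
  by rewrite -{1}(muln1 60) leq_pmul2l.
have hr : c * 120 ^ m < q %/ 60 by rewrite leq_divRL // mulnC.
have hq' : q <= 120 * (q %/ 60).
  have := ltn_ceil q (isT : 0 < 60); lia.
move: (q %/ 60) hr hq' => r hr hq'.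
have r0 : 0 < r by apply: leq_trans hr.
apply: (@leq_ltn_trans (c * 120 ^ m * r ^ m)).
  rewrite -mulnA -expnMn leq_mul2l; apply/orP; right.
  by case: (m) => // m'; rewrite leq_exp2r.
apply: (@leq_trans (r * r ^ m)); first by rewrite ltn_pmul2r // expn_gt0 r0.
by rewrite -expnS leq_pexp2l.
Qed.

Lemma min_in_seq (T : eqType) (F : T -> nat) (s : seq T) : 0 < size s ->
  exists2 x, x \in s & {in s, forall y, F x <= F y}.
Proof.
move=> s0; have ex : exists m, has (fun x => F x == m) s.
  by case: s s0 => // x s _; exists (F x); rewrite /= eqxx.
case: (ex_minnP ex) => m /hasP[x xs /eqP Fx] minm; exists x => // y ys.
by rewrite Fx; apply: minm; apply/hasP; exists y.
Qed.

Lemma last_scale (p : nat -> nat) (q0 k : nat) : p q0 <= k -> (forall q, q <= p q) ->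
  exists q, [/\ q0 <= q, p q <= k & k < p q.+1].
Proof.
move=> h0 hp; have ex : exists q, (q0 <= q) && (p q <= k) by exists q0; rewrite leqnn.
have bound q : (q0 <= q) && (p q <= k) -> q <= k.
  by case/andP=> _; apply: leq_trans.
case: (ex_maxnP ex bound) => q /andP[h1 h2] maxq; exists q; split=> //.
by rewrite ltnNge; apply/negP => h; have := maxq q.+1; rewrite h ltnn (leq_trans h1) // => /(_ isT).
Qed.

(** Let [q] be the last scale with [(2 * q) ^ 13 <= #|J|], so that [#|J|] is polynomial in [q]. If
    the teeth are small, [#|J|] and [t] are bounded through [alpha] and the clique number. Otherwise
    there are [q %/ 60] anticomplete blocks; the one of least [alpha] has at most a share
    [1 / (q %/ 60)] of the whole, and criticality makes it smaller than a block can be. *)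
Lemma core_bound (V : finType) (e : rel V) (V0 : {set V}) (u M q0 c : nat) :
  symmetric e -> irreflexive e -> no_shatter3 e -> c = 72 ^ 3 ->
  2 <= u -> 2 * 36 ^ u < M -> (36 * (2 * q0) ^ 13) ^ 2 <= M -> 60 <= q0 ->
  (forall q, q0 <= q -> c * (4 * q) ^ 39 * (2 * q) ^ 13 < (q %/ 60) ^ (2 * u)) ->
  {in V0, forall v, M * #|nb e v :&: V0| <= #|V0|} ->
  (forall X : {set V}, X \subset V0 ->
     alpha e V0 ^ (2 * u) * #|X| <= alpha e X ^ (2 * u) * #|V0|) ->
  #|V0| <= c * (alpha e V0 * alpha (compl_rel e) V0) ^ 5.
Proof.
move=> sym irr hVC cE u2 hM hMq q060 hq hdeg crit.
have [->|V0n] := eqVneq V0 set0; first by rewrite cards0.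
have al0 : 0 < alpha e V0 by apply: alpha_gt0.
have om0 : 0 < alpha (compl_rel e) V0 by apply: alpha_gt0 => //; apply: compl_rel_irr.
have c0 : 0 < c by rewrite cE expn_gt0.
have q00 : 0 < q0 by apply: leq_trans q060.
have hs := critical_structure sym irr u2 hM hdeg crit.
have {hs} hs : #|V0| <= alpha e V0 \/ exists (w : V) (J : {set V}) (T : V -> {set V}) (t : nat),
    [/\ {in V0 & &, forall x y z, exists v, [/\ v \notin [:: x; y; z], ~~ e v x, ~~ e v y & ~~ e v z]},
        comb_fam e V0 w J T t, 0 < t, #|V0| <= c * (#|J| ^ 3 * t) & M <= (36 * #|J|) ^ 2].
  case: hs => [|[w [J [T [t [h1 h2 h3 h4 h5]]]]]]; [by left|right].
  by exists w, J, T, t; split=> //; rewrite mulnA cE -expnMn.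
move: hM hMq {cE} => _ hMq.
set om := alpha (compl_rel e) V0 in om0 *; set al := alpha e V0 in al0 crit hs *.
have small m (x : nat) : m <= 5 -> x <= c * (al ^ m * om) -> x <= c * (al * om) ^ 5.
  move=> m5 /leq_trans; apply; rewrite leq_pmul2l // expnMn leq_mul ?leq_pexp2l //.
  by rewrite -{1}(expn1 om) leq_pexp2l.
case: hs => [h|[w [J [T [t [far fam t0 hn hMk]]]]]].
  apply: (small 1) => //; apply: leq_trans h _; rewrite expn1.
  by apply: leq_trans (leq_pmulr al om0) (leq_pmull _ c0).
have kal : #|J| <= al by apply: leq_alpha; case: fam.
have kq0 : (2 * q0) ^ 13 <= #|J|.
  have := leq_trans hMq hMk; rewrite leq_exp2r // leq_pmul2l //.
have [q'|q [q0q pq pq1]] := @last_scale (fun q => (2 * q) ^ 13) q0 #|J| kq0.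
  apply: (@leq_trans ((2 * q') ^ 1)); first by rewrite expn1 leq_pmull.
  by case: q' => // q'; rewrite leq_pexp2l.
have q0' : 0 < q by apply: leq_trans q0q.
have k4 : #|J| <= (4 * q) ^ 13.
  apply: leq_trans (ltnW pq1) _; rewrite leq_exp2r //; clear -q0'; lia.
have rq : 60 * (q %/ 60) <= q by rewrite mulnC leq_divM.
have r0 : 0 < q %/ 60 by rewrite divn_gt0 // (leq_trans q060).
move: (hq q q0q) => {}hq; clear hdeg hMq q060 hMk kq0 pq1.
case: (fam_dichotomy sym irr hVC far fam rq q0' t0 pq) => [ht|[Rs [sRs pRs hRs]]].
  apply: (small 4) => //; apply: leq_trans hn _.
  have h1 : t <= al * om.
    by apply: leq_trans ht _; rewrite leq_mul2r (leq_trans pq kal) orbT.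
  by rewrite leq_pmul2l // (expnSr al 3) -mulnA leq_mul // leq_exp2r.
have [R0 R0Rs minR] : exists2 R, R \in Rs & {in Rs, forall R' : {set V}, alpha e R <= alpha e R'}.
  by apply: min_in_seq; rewrite sRs.
have [R0V tR0] := hRs R0 R0Rs.
have R00 : 0 < #|R0| by rewrite lt0n; apply/eqP => E; move: tR0; rewrite E muln0 leqNgt t0.
have m0 : 0 < alpha e R0 by apply: alpha_gt0 => //; rewrite -card_gt0.
have hr : q %/ 60 * alpha e R0 <= al.
  rewrite -sRs; apply: alpha_blocks => // R RRs; have [RV _] := hRs R RRs.
  by split=> //; apply: minR.
exfalso; move: hq; rewrite ltnNge => /negP; apply.
have h1 : (q %/ 60) ^ (2 * u) * #|R0| <= #|V0|.
  have h2 : (q %/ 60 * alpha e R0) ^ (2 * u) * #|R0| <= alpha e R0 ^ (2 * u) * #|V0|.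
    apply: leq_trans (crit R0 R0V); rewrite leq_mul2r leq_exp2r ?hr ?orbT //.
    by clear -u2; lia.
  by move: h2; rewrite expnMn [_ ^ _ * _ ^ _]mulnC -mulnA leq_pmul2l // expn_gt0 m0.
rewrite -(leq_pmul2r R00); apply: leq_trans h1 (leq_trans hn _).
have h39 : #|J| ^ 3 <= (4 * q) ^ 39.
  by have -> : (4 * q) ^ 39 = ((4 * q) ^ 13) ^ 3; [rewrite -expnM|rewrite leq_exp2r].
move: ((4 * q) ^ 39) ((2 * q) ^ 13) (#|J| ^ 3) tR0 h39 => p39 p13 k3 tR0 h39.
by rewrite -!mulnA leq_pmul2l //; apply: leq_mul.
Qed.

Lemma mul_two_powers (c a b q x y : nat) :
  c * (a * q) ^ x * (b * q) ^ y = c * (a ^ x * b ^ y) * q ^ (x + y).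
Proof. by rewrite (expnMn a) (expnMn b) expnD -!mulnA [q ^ x * _]mulnCA. Qed.

Lemma core_theorem : exists s M C : nat, 0 < s /\
  forall (V : finType) (e : rel V) (V0 : {set V}),
    symmetric e -> irreflexive e -> no_shatter3 e ->
    {in V0, forall v, M * #|nb e v :&: V0| <= #|V0|} ->
    (forall X : {set V}, X \subset V0 ->
       alpha e V0 ^ s * #|X| <= alpha e X ^ s * #|V0|) ->
    #|V0| <= C * (alpha e V0 * alpha (compl_rel e) V0) ^ 5.
Proof.
(* The numerals are hidden behind variables to keep them from being computed. *)
have name (k : nat) : exists c, c = k by exists k.
have [[c cE] [d dE]] := (name (72 ^ 3), name (4 ^ 39 * 2 ^ 13)).
have [q0 [q060 hq0]] := eventually_lt_pow (c * d) (39 + 13).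
have [M [hM1 hM2]] : exists M, 2 * 36 ^ 27 < M /\ (36 * (2 * q0) ^ 13) ^ 2 <= M.
  exists ((36 * (2 * q0) ^ 13) ^ 2 + (2 * 36 ^ 27).+1).
  by split; [apply: leq_addl|apply: leq_addr].
(* [2 * 27 = 39 + 13 + 2]: here [39] comes from [#|J| ^ 3 <= (4 * q) ^ 39], [13] from the relative
   size of a block, and [2] from [eventually_lt_pow]. *)
exists (2 * 27), M, c; split=> //.
move=> V e V0 sym irr hVC hdeg crit.
have hq q : q0 <= q -> c * (4 * q) ^ 39 * (2 * q) ^ 13 < (q %/ 60) ^ (2 * 27).
  move=> /hq0; rewrite (_ : (39 + 13).+2 = 2 * 27) //.
  suff -> : c * (4 * q) ^ 39 * (2 * q) ^ 13 = c * d * q ^ (39 + 13) by [].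
  by rewrite dE; apply: (mul_two_powers c 4 2 q 39 13).
exact: (core_bound sym irr hVC cE (isT : 2 <= 27) hM1 hM2 q060 hq hdeg crit).
Qed.

(** * Sparse or dense subsets *)

Lemma pigeonhole_seq (V : finType) (T : eqType) (P : V -> pred T) (Y : {set V}) (s : seq T) :
  Y != set0 -> {in Y, forall u, has (P u) s} ->
  exists2 z, z \in s & #|Y| <= size s * #|[set u in Y | P u z]|.
Proof.
move=> Y0 hY; apply/hasP; apply: contraT => /hasPn hn.
have h c b (r : seq T) : {in r, forall z, c * #|[set u in Y | P u z]| <= b} ->
    c * #|[set u in Y | has (P u) r]| <= size r * b.
  elim: r => [|z r IH] hr /=.
    by rewrite (_ : [set _ in _ | _] = set0) ?cards0 ?muln0 //; apply/setP => u; rewrite !inE andbF.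
  rewrite (_ : [set _ in _ | _] = [set u in Y | P u z] :|: [set u in Y | has (P u) r]).
    apply: leq_trans (leq_mul (leqnn c) (card_setU_leq _ _)) _.
    rewrite mulnDr mulSn leq_add ?hr ?mem_head //.
    by apply: IH => z' z'r; apply: hr; rewrite inE z'r orbT.
  by apply/setP => u; rewrite !inE andb_orr.
have := h (size s) #|Y|.-1 s.
rewrite (_ : [set u in Y | _] = Y); last first.
  by apply/setP => u; rewrite inE; apply/andb_idr/hY.
have Y1 : 0 < #|Y| by rewrite card_gt0.
have s0 : 0 < size s.
  by case/set0Pn: Y0 => u /hY; case: (s).
rewrite leq_pmul2l // => h1.
have : #|Y| <= #|Y|.-1 by apply: h1 => z /hn; lia.
by lia.
Qed.

Section Pairs.

Variables (V : finType) (e : rel V).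
Hypotheses (sym : symmetric e) (hVC : no_shatter3 e).

Definition splits (m : nat) (u : V) (Z : {set V}) : bool :=
  (#|Z| < m * #|nb e u :&: Z|) && (#|Z| < m * #|Z :\: nb e u|).

Definition cut (u : V) (b : bool) (Z : {set V}) : {set V} :=
  if b then nb e u :&: Z else Z :\: nb e u.

Lemma cutP u b Z x : x \in cut u b Z -> (x \in Z) /\ e u x = b.
Proof. by case: b; rewrite /cut !inE => /andP[h1 h2]; split=> //; apply/negbTE. Qed.

Lemma splits_cut m u b (Z : {set V}) : splits m u Z -> #|Z| < m * #|cut u b Z|.
Proof. by case/andP; case: b. Qed.

Definition sparse_pair (f : rel V) (m : nat) (Y Z : {set V}) : Prop :=
  {in Y, forall y, m * #|nb f y :&: Z| <= #|Z|}.

(** Each vertex of [X1] outside [U] is nearly complete or nearly anticomplete to one of at most four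
    cells. By pigeonhole over cells and sides, an eighth of these vertices agree; the [2] accounts
    for [U]. *)
Lemma unsplit_pair (m : nat) (X1 X2 U : {set V}) (cells : seq {set V}) :
  [disjoint X1 & X2] -> 0 < size cells <= 4 -> #|U| <= 2 -> 2 < #|X1| ->
  {in cells, forall Z : {set V}, Z \subset X2 /\ #|X2| <= m ^ 2 * #|Z|} ->
  {in X1 :\: U, forall u, ~~ all (splits m u) cells} ->
  exists Y Z : {set V}, [/\ Y \subset X1, Z \subset X2, #|X1| <= 8 * #|Y| + 2,
    #|X2| <= m ^ 2 * #|Z| & sparse_pair e m Y Z \/ sparse_pair (compl_rel e) m Y Z].
Proof.
move=> dX /andP[c0 c4] cU cX hcells hsplit.
have cXU : #|X1| <= #|X1 :\: U| + 2.
  have := cardsID U X1; have : #|X1 :&: U| <= #|U| by apply/subset_leq_card/subsetIr.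
  by lia.
have [|u /hsplit|Z Zc hZ] := @pigeonhole_seq V _ (fun u Z => ~~ splits m u Z) (X1 :\: U) cells.
- by rewrite -card_gt0; lia.
- by rewrite -has_predC.
have [ZX cZ] := hcells Z Zc.
pose W b := [set u in X1 :\: U | ~~ (#|Z| < m * #|cut u b Z|)].
have WX b : W b \subset X1 by apply/subsetP => u; rewrite !inE => /andP[/andP[_ ->]].
have hW : #|[set u in X1 :\: U | ~~ splits m u Z]| <= #|W true| + #|W false|.
  apply: leq_trans (card_setU_leq _ _); apply/subset_leq_card/subsetP => u.
  by rewrite !inE /splits /cut negb_and -andb_orr.
have hX b : #|W (~~ b)| <= #|W b| -> #|X1| <= 8 * #|W b| + 2.
  move=> hb; have h1 : #|W true| + #|W false| <= 2 * #|W b| by move: b hb => [] /=; lia.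
  have h2 : size cells * #|[set u in X1 :\: U | ~~ splits m u Z]| <= 4 * (2 * #|W b|).
    by apply: leq_mul => //; apply: leq_trans hW h1.
  have h3 := leq_trans hZ h2; by lia.
have [hle|hlt] := leqP #|W false| #|W true|.
  exists (W true), Z; split=> //; first exact: hX true hle.
  by left=> u; rewrite inE -leqNgt => /andP[].
exists (W false), Z; split=> //; first exact: hX false (ltnW hlt).
right=> u uW; have uX := subsetP (WX false) u uW.
move: uW; rewrite inE -leqNgt => /andP[_]; apply: leq_trans.
rewrite leq_mul2l; apply/orP; right; apply/subset_leq_card/subsetP => x.
by rewrite !inE /compl_rel => /andP[/andP[_ ->] ->].
Qed.

(** Halve [X] and look in one half for [u1], [u2], [u3], each splitting all cells cut out of the
    other half so far. If all three exist, the eight final cells are inhabited and the triple is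
    shattered by rows off the columns; where the search stops, [unsplit_pair] applies. *)
Lemma sparse_or_dense_pair (m : nat) (X : {set V}) : 0 < m -> 10 <= #|X| ->
  exists Y Z : {set V}, [/\ [/\ Y \subset X, Z \subset X & [disjoint Y & Z]],
    #|Y| <= #|Z|, #|X| <= 32 * m ^ 2 * #|Y| &
    sparse_pair e m Y Z \/ sparse_pair (compl_rel e) m Y Z].
Proof.
move=> m0 X10.
have [X1 X1X cX1] := @subset_of_card V X (#|X| %/ 2) (leq_div _ _).
pose X2 := X :\: X1.
have cX2 : #|X| = #|X1| + #|X2| by rewrite cardsD (setIidPr X1X) subnKC // subset_leq_card.
have dX : [disjoint X1 & X2] by rewrite disjoint_sym disjoints_subset subsetDr.
suff [Y0 [Z [Y0X ZX hY0 hZ hYZ]]] : exists Y Z : {set V}, [/\ Y \subset X1, Z \subset X2,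
    #|X1| <= 8 * #|Y| + 2, #|X2| <= m ^ 2 * #|Z| &
    sparse_pair e m Y Z \/ sparse_pair (compl_rel e) m Y Z].
  have [Y YY0 cY] := subset_of_card (geq_minl #|Y0| #|Z|).
  exists Y, Z; split.
  - split; first by apply: subset_trans YY0 (subset_trans Y0X X1X).
      exact: subset_trans ZX (subsetDl _ _).
    exact: disjointWl (subset_trans YY0 Y0X) (disjointWr ZX dX).
  - by rewrite cY geq_minr.
  - have mm : 0 < m ^ 2 by rewrite expn_gt0 m0.
    by rewrite cY /minn; case: ltnP => _; nia.
  by case: hYZ => h; [left|right] => y /(subsetP YY0); apply: h.
have X13 : 2 < #|X1| by lia.
have up := unsplit_pair dX _ _ X13.
have mm1 : 1 <= m ^ 2 by rewrite expn_gt0 m0.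
have [/exists_inP[u1 u1X s1]|/exists_inPn n1] := boolP [exists u in X1, splits m u X2]; last first.
  apply: (up m set0 [:: X2]); rewrite ?cards0 //.
    by move=> Z; rewrite inE => /eqP->; rewrite subxx leq_pmull.
  by move=> u; rewrite setD0 /= andbT; apply: n1.
pose c1 b := cut u1 b X2.
have c1X b : c1 b \subset X2 by apply/subsetP => x /cutP[].
have hc1 b : #|X2| < m * #|c1 b| := splits_cut b s1.
have [/exists_inP[u2 u2X s2]|/exists_inPn n2] :=
    boolP [exists u in X1 :\ u1, splits m u (c1 true) && splits m u (c1 false)]; last first.
  apply: (up m [set u1] [:: c1 true; c1 false]); rewrite ?cards1 //.
    have h b : #|X2| <= m ^ 2 * #|c1 b|.
      by apply: leq_trans (ltnW (hc1 b)) _; rewrite leq_mul2r -{1}(expn1 m) leq_pexp2l ?orbT.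
    by move=> Z; rewrite !inE => /orP[]/eqP->; rewrite c1X h.
  by move=> u uX /=; rewrite andbT; apply: n2.
have {s2} s2 b : splits m u2 (c1 b) by case/andP: s2; case: b.
pose c2 b b' := cut u2 b' (c1 b).
have c2X b b' : c2 b b' \subset X2 by apply: subset_trans (c1X b); apply/subsetP => x /cutP[].
have hc2 b b' : #|c1 b| < m * #|c2 b b'| := splits_cut b' (s2 b).
pose cells := [:: c2 true true; c2 true false; c2 false true; c2 false false].
have [/exists_inP[u3 u3X s3]|/exists_inPn n3] :=
    boolP [exists u in X1 :\: [set u1; u2], all (splits m u) cells]; last first.
  apply: (up m [set u1; u2] cells); rewrite ?cards2 //; first by case: (_ != _).
    have h b b' : #|X2| <= m ^ 2 * #|c2 b b'|.
      by rewrite -mulnn -mulnA; apply: leq_trans (ltnW (hc1 b)) _; rewrite leq_mul2l ltnW ?orbT.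
    by move=> Z; rewrite !inE => /or4P[]/eqP->; rewrite c2X h.
exfalso; apply: (hVC (x := u1) (y := u2) (z := u3)); split.
  move: u2X u3X; rewrite /= !inE !negb_or ![u2 == u1]eq_sym ![u3 == _]eq_sym /=.
  by move=> /andP[-> _] /andP[/andP[-> ->] _].
move=> b b' b''.
have s3' : splits m u3 (c2 b b') by move: s3; rewrite /cells /= => /and5P[]; case: b b' => [] [].
have /card_gt0P[x xc] : 0 < #|cut u3 b'' (c2 b b')|.
  by have := splits_cut b'' s3'; case: #|cut _ _ _| => //; rewrite muln0.
have [xc2 e3] := cutP xc; have [xc1 e2] := cutP xc2; have [xX2 e1] := cutP xc1.
exists x; rewrite ![e x _]sym; split=> //.
have nx u : u \in X1 -> x != u.
  by move=> uX; apply/eqP => E; have := disjointFr dX uX; rewrite -E xX2.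
move: u2X u3X; rewrite !inE => /andP[_ u2X] /andP[_ u3X].
by rewrite !negb_or !nx.
Qed.

End Pairs.

(** * From sparse pairs to sparse sets *)

Lemma light_subset (V : finType) (f : V -> nat) (m A j : nat) (Z : {set V}) :
  m * \sum_(z in Z) f z <= A * #|Z| -> j <= #|Z| ->
  exists Z' : {set V}, [/\ Z' \subset Z, #|Z'| = j & m * \sum_(z in Z') f z <= A * j].
Proof.
have [k hk] := ubnP #|Z|; elim: k Z hk => // k IH Z hk hZ.
rewrite leq_eqVlt => /predU1P[->|jZ]; first by exists Z; rewrite subxx.
(* Dropping a heaviest element preserves the bound: either its weight is at least the allowed
   average [A / m], or all weights are below it. *)
have [z zZ hz] : exists2 z, z \in Z & m * \sum_(y in Z :\ z) f y <= A * #|Z :\ z|.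
  have [z0 z0Z] : exists z, z \in Z by apply/card_gt0P; apply: leq_ltn_trans jZ.
  have [z zZ maxz] := @arg_maxnP _ z0 (fun z => z \in Z) f z0Z.
  have cZ : #|Z| = #|Z :\ z|.+1 by rewrite (cardsD1 z) zZ.
  exists z => //; have [h|h] := leqP A (m * f z).
    by move: hZ; rewrite (big_setD1 z) //= cZ mulnDr mulnS; lia.
  rewrite big_distrr mulnC -sum_nat_const; apply: leq_sum => y /setD1P[_ yZ] /=.
  by apply: leq_trans (ltnW h); rewrite leq_mul2l (maxz y yZ : f y <= f z) orbT.
have cZ : #|Z| = #|Z :\ z|.+1 by rewrite (cardsD1 z) zZ.
have [||Z' [Z'Z cZ' hZ']] := IH (Z :\ z) _ hz; [lia|lia|].
by exists Z'; split=> //; apply: subset_trans Z'Z (subsetDl _ _).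
Qed.

(** The degree sum is that of [p] parts of size [a] with arbitrary edges inside parts, at most
    [p * a ^ 2], and density [1 / m] between them, at most [p ^ 2 * a ^ 2 / m]. *)
Definition thin (V : finType) (e : rel V) (m p c : nat) (X : {set V}) : Prop :=
  exists (S : {set V}) (a : nat), [/\ S \subset X, #|S| = p * a, #|X| <= c * a &
    m * \sum_(v in S) #|nb e v :&: S| <= (p * m + p ^ 2) * a ^ 2].

Lemma thin1 (V : finType) (e : rel V) (m c : nat) (X : {set V}) :
  0 < c -> thin e m 1 c X.
Proof.
move=> c0; exists X, #|X|; rewrite subxx mul1n; split=> //; first by rewrite leq_pmull.
rewrite mul1n exp1n mulnDl mul1n; apply: leq_trans (leq_addr _ _).
rewrite leq_mul2l -mulnn; apply/orP; right; rewrite -sum_nat_const.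
by apply: leq_sum => v _; apply/subset_leq_card/subsetIr.
Qed.

Lemma thin_leq (V : finType) (e : rel V) (m p c d : nat) (X : {set V}) :
  c <= d -> thin e m p c X -> thin e m p d X.
Proof.
move=> cd [S [a [h1 h2 h3 h4]]]; exists S, a; split=> //.
by apply: leq_trans h3 _; rewrite leq_mul2r cd orbT.
Qed.

(** The new part consists of [a] vertices of [Z] with few neighbours in [S] on average. It
    contributes at most [a ^ 2] inside and twice [p * a ^ 2 / m] across. *)
Lemma thin_extend (V : finType) (e : rel V) (m p c d : nat) (X Y Z : {set V}) :
  symmetric e -> 0 < p -> Y \subset X -> Z \subset X -> [disjoint Y & Z] ->
  #|Y| <= #|Z| -> #|X| <= d * #|Y| -> sparse_pair e m Y Z ->
  thin e m p c Y -> thin e m p.+1 (d * c) X.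
Proof.
move=> sym p0 YX ZX dYZ cYZ hX hYZ [S [a [SY cS hY hS]]].
have aZ : a <= #|Z|.
  apply: leq_trans cYZ; apply: leq_trans (subset_leq_card SY).
  by rewrite cS leq_pmull.
have [|Z' [Z'Z cZ' hZ']] := @light_subset V (fun z => #|nb e z :&: S|) m #|S| a Z _ aZ.
  rewrite -edge_count // big_distrr -sum_nat_const; apply: leq_sum => y yS.
  by apply: hYZ; apply: (subsetP SY).
have dSZ : [disjoint S & Z'] by apply: disjointWl SY (disjointWr Z'Z dYZ).
exists (S :|: Z'), a; split.
- by rewrite subUset (subset_trans SY YX) (subset_trans Z'Z ZX).
- by rewrite cardsU (disjoint_setI0 dSZ) cards0 subn0 cS cZ' mulSn addnC.
- by apply: leq_trans hX _; rewrite -mulnA leq_mul2l hY orbT.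
have split_deg v : #|nb e v :&: (S :|: Z')| <= #|nb e v :&: S| + #|nb e v :&: Z'|.
  by rewrite setIUr card_setU_leq.
apply: (@leq_trans (m * (\sum_(v in S) #|nb e v :&: S| + 2 * \sum_(v in Z') #|nb e v :&: S| + a ^ 2))).
  rewrite leq_mul2l; apply/orP; right.
  rewrite (big_setID S) /= setUK setDUl setDv set0U (setDidPl _) 1?disjoint_sym //.
  have h0 : 2 * \sum_(v in Z') #|nb e v :&: S| =
      \sum_(v in S) #|nb e v :&: Z'| + \sum_(v in Z') #|nb e v :&: S|.
    by rewrite edge_count // mul2n addnn.
  have h : \sum_(v in Z') #|nb e v :&: Z'| <= a ^ 2.
    rewrite -mulnn -{1}cZ' -sum_nat_const; apply: leq_sum => v _; rewrite -cZ'.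
    exact/subset_leq_card/subsetIr.
  have h1 : \sum_(v in S) #|nb e v :&: (S :|: Z')| <=
     \sum_(v in S) #|nb e v :&: S| + \sum_(v in S) #|nb e v :&: Z'|.
    by rewrite -big_split; apply: leq_sum.
  have h2 : \sum_(v in Z') #|nb e v :&: (S :|: Z')| <=
     \sum_(v in Z') #|nb e v :&: S| + \sum_(v in Z') #|nb e v :&: Z'|.
    by rewrite -big_split; apply: leq_sum.
  lia.
rewrite cS in hZ'; rewrite -!mulnn in hS *.
have : 0 <= p * a * a by [].
nia.
Qed.

(** The induction is that for Ramsey numbers: a sparse pair adds a part to a thin set found in [Y],
    a dense pair does so in the complement, and otherwise the induction hypothesis already gives the
    other outcome. *)
Lemma ramsey_thin (m p q : nat) : 0 < m -> exists c, 0 < c /\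
  forall (V : finType) (e : rel V) (X : {set V}), symmetric e -> no_shatter3 e -> c <= #|X| ->
  thin e m p.+1 c X \/ thin (compl_rel e) m q.+1 c X.
Proof.
move=> m0; have [k] := ubnP (p + q); elim: k p q => // k IH p q hk.
case: p hk => [|p] hk; first by exists 1; split=> // *; left; apply: thin1.
case: q hk => [|q] hk; first by exists 1; split=> // *; right; apply: thin1.
have [|c1 [c10 h1]] := IH p q.+1; first by lia.
have [|c2 [c20 h2]] := IH p.+1 q; first by lia.
pose d := 32 * m ^ 2; have d0 : 0 < d by rewrite muln_gt0 expn_gt0 m0.
have le c : c <= c1 + c2 + 10 -> c <= d * (c1 + c2 + 10) /\ d * c <= d * (c1 + c2 + 10).
  by move=> h; split; [apply: leq_trans h _; rewrite leq_pmull|rewrite leq_mul2l h orbT].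
exists (d * (c1 + c2 + 10)); split=> [|V e X sym hVC hX].
  by rewrite muln_gt0 d0; lia.
have [|Y [Z [[YX ZX dYZ] cYZ cX]]] := @sparse_or_dense_pair V e sym hVC m X m0.
  by apply: leq_trans hX; case: (le 10); first by lia.
have cY : c1 + c2 + 10 <= #|Y| by rewrite -(leq_pmul2l d0); apply: leq_trans hX cX.
have [] := (le c1, le c2).
move=> /(_ _)[]; first lia; move=> l1 l1' /(_ _)[]; first lia; move=> l2 l2'.
case=> hYZ.
  have [|h|h] := h1 V e Y sym hVC; first by lia.
    by left; apply: thin_leq l1' _; apply: thin_extend sym _ YX ZX dYZ cYZ cX hYZ h.
  right; case: h => S [a [SY cS hY hS]]; exists S, a; split=> //.
    exact: subset_trans SY YX.
  apply: leq_trans cX _; apply: (@leq_trans (d * c1 * a)); first by rewrite -[d * c1 * a]mulnA leq_mul2l hY orbT.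
  by rewrite leq_mul2r l1' orbT.
have [|h|h] := h2 V e Y sym hVC; first by lia.
  left; case: h => S [a [SY cS hY hS]]; exists S, a; split=> //.
    exact: subset_trans SY YX.
  apply: leq_trans cX _; apply: (@leq_trans (d * c2 * a)); first by rewrite -[d * c2 * a]mulnA leq_mul2l hY orbT.
  by rewrite leq_mul2r l2' orbT.
right; apply: thin_leq l2' _; apply: thin_extend (compl_rel_sym sym) _ YX ZX dYZ cYZ cX hYZ h => //.
Qed.

(** With [p = m = 8 * M] the degree sum times [8 * M] is at most [2 * #|S| ^ 2]. By Markov's
    inequality at most half of the vertices have degree above [#|S| / (2 * M)], and these are
    removed. *)
Lemma thin_prune (V : finType) (e : rel V) (M c : nat) (X : {set V}) : 0 < M -> 0 < #|X| ->
  thin e (8 * M) (8 * M) c X ->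
  exists S : {set V}, [/\ S \subset X, S != set0, #|X| <= 2 * c * #|S| &
    {in S, forall v, M * #|nb e v :&: S| <= #|S|}].
Proof.
move=> M0 X0 [S [a [SX cS hX hS]]].
have a0 : 0 < a by rewrite lt0n; apply/eqP => a0; move: hX; rewrite a0 muln0; lia.
have S0 : 0 < #|S| by rewrite cS !muln_gt0 M0.
pose Bad := [set v in S | 4 * #|S| < 8 * M * #|nb e v :&: S|].
have hBad : 2 * #|Bad| <= #|S|.
  have h1 : #|Bad| * (4 * #|S|) <= 8 * M * \sum_(v in S) #|nb e v :&: S|.
    rewrite (big_setID Bad) /= mulnDr (setIidPr _); last by apply/subsetP => v; rewrite inE => /andP[].
    apply: leq_trans (leq_addr _ _); rewrite big_distrr -sum_nat_const; apply: leq_sum => v.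
    by rewrite inE => /andP[_ /ltnW].
  have h2 := leq_trans h1 hS; rewrite -!mulnn in h2.
  have h3 : (8 * M * (8 * M) + 8 * M * (8 * M)) * (a * a) = 2 * #|S| * #|S| by rewrite cS; lia.
  rewrite h3 in h2; rewrite -(leq_pmul2r S0); lia.
have cD : #|S| <= 2 * #|S :\: Bad|.
  have h : #|S :&: Bad| <= #|Bad| by apply/subset_leq_card/subsetIr.
  by have := cardsID Bad S; lia.
exists (S :\: Bad); split.
- exact: subset_trans (subsetDl _ _) SX.
- by rewrite -card_gt0; lia.
- have : c * a <= c * (2 * #|S :\: Bad|).
    by rewrite leq_mul2l; apply/orP; right; apply: leq_trans cD; rewrite cS leq_pmull // muln_gt0 M0.
  by lia.
move=> v /setDP[vS]; rewrite inE vS /= -leqNgt => h.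
have : #|nb e v :&: (S :\: Bad)| <= #|nb e v :&: S| by apply/subset_leq_card/setIS/subsetDl.
by move=> h1; have := leq_mul (leqnn M) h1; lia.
Qed.

Lemma roedl (M : nat) : exists D, forall (V : finType) (e : rel V) (X : {set V}),
  symmetric e -> irreflexive e -> no_shatter3 e -> X != set0 ->
  exists S : {set V}, [/\ S \subset X, S != set0, #|X| <= D * #|S| &
    {in S, forall v, M * #|nb e v :&: S| <= #|S|} \/
    {in S, forall v, M * #|nb (compl_rel e) v :&: S| <= #|S|}].
Proof.
wlog M0 : M / 0 < M.
  move=> H; case: M => [|M]; last exact: H.
  have [D hD] := H 1 isT; exists D => V e X sym irr hVC X0.
  by have [S [h1 h2 h3 _]] := hD V e X sym irr hVC X0; exists S; split=> //; left.
have m0 : 0 < 8 * M by rewrite muln_gt0.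
have [c [c0 hc]] := ramsey_thin (8 * M).-1 (8 * M).-1 m0; rewrite prednK // in hc.
exists (2 * c) => V e X sym irr hVC Xn; have X0 : 0 < #|X| by rewrite card_gt0.
have [hX|hX] := leqP c #|X|.
  case: (hc V e X sym hVC hX) => /(thin_prune M0 X0)[S [h1 h2 h3 h4]]; exists S; split=> //.
    by left.
  by right.
(* A set smaller than the constant [c] is represented by a single point. *)
case/set0Pn: Xn => x xX; exists [set x]; rewrite sub1set xX cards1 -card_gt0 cards1; split=> //.
  by lia.
left=> v /set1P->; rewrite (_ : _ :&: _ = set0) ?cards0 ?muln0 //.
by apply/setP => y; rewrite !inE; case: eqP => [->|]; rewrite ?irr ?andbF.
Qed.

(** * Minimising homogeneous sets relative to size *)

Lemma expn_monotone (s m n : nat) : m <= n -> m ^ s <= n ^ s.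
Proof. by case: s => // s; rewrite leq_exp2r. Qed.

(** This minimises the ratio [g / h], cross-multiplied to stay in [nat]. *)
Lemma min_ratio (T : finType) (P : pred T) (g h : T -> nat) (x0 : T) :
  P x0 -> (forall x, P x -> 0 < h x) ->
  exists2 x, P x & forall y, P y -> g x * h y <= g y * h x.
Proof.
move=> Px0 h0.
have H (s : seq T) : all P s -> s != [::] ->
    exists2 x, P x & {in s, forall y, g x * h y <= g y * h x}.
  elim: s => // x s IH /= /andP[Px Ps] _; have [->|sn] := eqVneq s [::].
    by exists x => // y; rewrite inE => /eqP->.
  have [z Pz hz] := IH Ps sn; have [hxz|hzx] := leqP (g x * h z) (g z * h x).
    exists x => // y; rewrite inE => /predU1P[->//|ys].
    rewrite -(leq_pmul2r (h0 z Pz)); have := hz y ys => h1.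
    have := leq_mul hxz (leqnn (h y)); have := leq_mul h1 (leqnn (h x)); lia.
  exists z => // y; rewrite inE => /predU1P[->|ys]; last exact: hz.
  exact: ltnW.
have [||x Px hx] := H (enum P).
- by apply/allP => x; rewrite mem_enum.
- by apply/eqP => E; have := mem_enum P x0; rewrite E in_nil => /esym; rewrite unfold_in Px0.
by exists x => // y Py; apply: hx; rewrite mem_enum.
Qed.

Lemma stab_ext (V : finType) (e f : rel V) (A : {set V}) : e =2 f -> stab e A = stab f A.
Proof. by move=> ef; apply: eq_forallb_in => x _; apply: eq_forallb_in => y _; rewrite ef. Qed.

Lemma alpha_ext (V : finType) (e f : rel V) (X : {set V}) : e =2 f -> alpha e X = alpha f X.
Proof. by move=> ef; apply: eq_bigl => A; rewrite (stab_ext _ ef). Qed.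

Section Critical.

Variables (V : finType) (e : rel V).

Definition homog (X : {set V}) : nat := alpha e X * alpha (compl_rel e) X.

Lemma homogS (X Y : {set V}) : X \subset Y -> homog X <= homog Y.
Proof. by move=> XY; apply: leq_mul; apply: alphaS. Qed.

Hypotheses (sym : symmetric e) (irr : irreflexive e).

Lemma homog_gt0 (X : {set V}) : X != set0 -> 0 < homog X.
Proof.
by move=> X0; rewrite muln_gt0 !alpha_gt0 //; apply: compl_rel_irr.
Qed.

(** The other factor of [homog] does not increase on passing to a subset, so it can be cancelled. *)
Lemma critical_factor (s : nat) (Z : {set V}) : Z != set0 ->
  (forall X : {set V}, X != set0 -> X \subset Z -> homog Z ^ s * #|X| <= homog X ^ s * #|Z|) ->
  (forall X : {set V}, X \subset Z -> alpha e Z ^ s * #|X| <= alpha e X ^ s * #|Z|) /\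
  (forall X : {set V}, X \subset Z ->
     alpha (compl_rel e) Z ^ s * #|X| <= alpha (compl_rel e) X ^ s * #|Z|).
Proof.
move=> Z0 crit; have := homog_gt0 Z0; rewrite muln_gt0 => /andP[a0 o0].
split=> X XZ; have [->|X0] := eqVneq X set0; rewrite ?cards0 ?muln0 //.
  have := crit X X0 XZ; rewrite /homog !expnMn => h.
  rewrite -(@leq_pmul2l (alpha (compl_rel e) Z ^ s)) ?expn_gt0 ?o0 // mulnA [_ ^ s * _ ^ s]mulnC.
  apply: leq_trans h _; rewrite mulnA leq_mul2r [_ ^ s * _ ^ s]mulnC leq_mul2r.
  by apply/orP; right; apply/orP; right; apply: expn_monotone; apply: alphaS.
have := crit X X0 XZ; rewrite /homog !expnMn => h.
rewrite -(@leq_pmul2l (alpha e Z ^ s)) ?expn_gt0 ?a0 // mulnA.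
apply: leq_trans h _; rewrite mulnA leq_mul2r leq_mul2r.
by apply/orP; right; apply/orP; right; apply: expn_monotone; apply: alphaS.
Qed.

End Critical.

(** Two minimisations are nested: [X] for a large exponent, then [Z] for the exponent [s] inside the
    sparse or dense [S] found in [X]. Minimality of [X] keeps [Z] above half of [S], so [Z] inherits
    the sparseness and [core_theorem] applies to it, in the graph or in the complement. *)
Lemma polynomial_homog : exists c d : nat, forall (V : finType) (e : rel V),
  symmetric e -> irreflexive e -> no_shatter3 e -> #|V| <= c * homog e [set: V] ^ d.
Proof.
have [s [M [C [s0 core]]]] := core_theorem.
have [D hD] := roedl (2 * M).
pose j := D + 5; pose s' := s * j.+1.
exists (2 * D * C), s' => V e sym irr hVC.
have [V0|[v _]] := set_0Vmem [set: V]; first by rewrite -cardsT V0 cards0.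
have T0 : [set: V] != set0 by apply/set0Pn; exists v.
have card0 (X : {set V}) : X != set0 -> 0 < #|X| by rewrite card_gt0.
have [X X0 minX] := @min_ratio _ (fun X : {set V} => X != set0) (fun X => homog e X ^ s')
  (fun X => #|X|) _ T0 card0.
have [S [SX S0 cX hS]] := hD V e X sym irr hVC X0.
have [|Z /andP[Z0 ZS] minZ] := @min_ratio _ (fun Z : {set V} => (Z != set0) && (Z \subset S))
  (fun Z => homog e Z ^ s) (fun Z => #|Z|) S (introT andP (conj S0 (subxx S))).
  by move=> Z /andP[/card0].
have [fX0 fZ0] := (homog_gt0 irr X0, homog_gt0 irr Z0).
(* Raising the minimality of [Z] to the power [j + 1] and multiplying by that of [X] gives
   [#|S| ^ (j + 1) <= #|Z| ^ j * #|X|], where [#|X| <= D * #|S|]. So [2 * #|Z| <= #|S|] would imply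
   [2 ^ j <= D], but [D <= j]. *)
have cS : #|S| < 2 * #|Z|.
  have h1 : homog e X ^ s' * #|Z| <= homog e Z ^ s' * #|X| := minX Z Z0.
  have h2 : (homog e Z ^ s * #|S|) ^ j.+1 <= (homog e S ^ s * #|Z|) ^ j.+1.
    by rewrite leq_exp2r //; apply: minZ; rewrite S0 subxx.
  rewrite !(expnMn _ _ j.+1) -!(expnM (homog e _)) -/s' in h2.
  have h3 : homog e S ^ s' <= homog e X ^ s' by apply: expn_monotone; apply: homogS.
  have [Z1 S1] := (card0 _ Z0, card0 _ S0).
  have fZs : 0 < homog e Z ^ s' by rewrite expn_gt0 fZ0.
  have fXs : 0 < homog e X ^ s' by rewrite expn_gt0 fX0.
  have h4 : #|S| ^ j.+1 <= #|Z| ^ j * (D * #|S|).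
    move: h1 h2 h3 fZs fXs; rewrite [#|Z| ^ j.+1]expnSr.
    move: (homog e Z ^ s') (homog e S ^ s') (homog e X ^ s') => a b c h1 h2 h3 a0 c0'.
    apply: (@leq_trans (#|Z| ^ j * #|X|)); last by rewrite leq_mul2l cX orbT.
    rewrite -(@leq_pmul2l (a * c * #|Z|)) ?muln_gt0 ?a0 ?c0' //.
    have h5 := leq_mul h1 h2; have h6 := leq_mul h3 (leqnn (a * #|X| * (#|Z| ^ j * #|Z|))).
    move: h5 h6; move: (#|S| ^ j.+1) (#|Z| ^ j) => p q h5 h6; lia.
  rewrite expnSr mulnA leq_pmul2r // in h4.
  rewrite ltnNge; apply/negP => h.
  have h5 : (2 * #|Z|) ^ j <= #|S| ^ j by apply: expn_monotone.
  have h6 := leq_trans h5 h4; rewrite expnMn mulnC leq_pmul2l ?expn_gt0 ?Z1 // in h6.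
  have h7 : j < 2 ^ j := ltn_expl j (isT : 1 < 2).
  by have : D <= j := leq_addr 5 D; lia.
have critZ (Y : {set V}) : Y != set0 -> Y \subset Z ->
    homog e Z ^ s * #|Y| <= homog e Y ^ s * #|Z|.
  by move=> Y0 YZ; apply: minZ; rewrite Y0 (subset_trans YZ ZS).
have [critA critO] := critical_factor irr Z0 critZ.
have sparse (f : rel V) : {in S, forall v, 2 * M * #|nb f v :&: S| <= #|S|} ->
    {in Z, forall v, M * #|nb f v :&: Z| <= #|Z|}.
  move=> h u uZ; have h1 := h u (subsetP ZS u uZ).
  have h2 : #|nb f u :&: Z| <= #|nb f u :&: S| by apply/subset_leq_card/setIS.
  have h3 := leq_mul (leqnn M) h2; lia.
have hZ : #|Z| <= C * homog e Z ^ 5.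
  case: hS => /sparse hZ; first exact: core sym irr hVC hZ critA.
  have := core V (compl_rel e) Z (compl_rel_sym sym) (@compl_rel_irr _ e)
    (no_shatter3_compl hVC) hZ critO.
  by rewrite (alpha_ext _ (compl_relK irr)) mulnC /homog [alpha e Z * _]mulnC mulnC.
have hX5 : homog e Z ^ 5 <= homog e X ^ s'.
  apply: (@leq_trans (homog e X ^ 5)).
    by apply: expn_monotone; apply: homogS; apply: subset_trans ZS SX.
  rewrite leq_pexp2l // /s' /j; apply: (@leq_trans (1 * (D + 5).+1)); first by rewrite mul1n; lia.
  by rewrite leq_mul2r s0 orbT.
have hX : #|X| <= 2 * D * C * homog e X ^ s'.
  have h1 := leq_mul (leqnn D) (ltnW cS); have h2 := leq_mul (leqnn (2 * D)) hZ.
  have h3 := leq_mul (leqnn (2 * D * C)) hX5; lia.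
(* Comparing [X] with the whole vertex set, the factor [homog e X ^ s'] cancels. *)
have := minX [set: V] T0; rewrite cardsT => h.
have h1 := leq_trans h (leq_mul (leqnn _) hX).
by rewrite -(@leq_pmul2l (homog e X ^ s')) ?expn_gt0 ?fX0 //; lia.
Qed.

Lemma large_homogeneous_set : exists d : nat, 0 < d /\
  forall (V : finType) (e : rel V), symmetric e -> irreflexive e -> no_shatter3 e ->
  exists A : {set V}, (stab e A \/ stab (compl_rel e) A) /\ #|V| <= #|A| ^ d.
Proof.
have [c [d h]] := polynomial_homog; exists (2 * d + c).+1; split=> // V e sym irr hVC.
have [A [_ sA cA]] := alphaP e [set: V]; have [B [_ sB cB]] := alphaP (compl_rel e) [set: V].
suff : #|V| <= maxn #|A| #|B| ^ (2 * d + c).+1.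
  by case: (leqP #|A| #|B|) => _ hV; [exists B|exists A]; split=> //; [right|left].
have hV : #|V| <= c * (maxn #|A| #|B|) ^ (2 * d).
  apply: leq_trans (h V e sym irr hVC) _; rewrite leq_mul2l mulnC expnM; apply/orP; right.
  by rewrite -expnM mulnC expnM; apply: expn_monotone; rewrite -mulnn /homog -cA -cB leq_mul ?leq_maxl ?leq_maxr.
have [V1|V2] := leqP #|V| 1.
  move: V1; rewrite leq_eqVlt ltnS leqn0 => /predU1P[V1|/eqP->//].
  rewrite V1 expn_gt0 orbF leq_max cA alpha_gt0 //.
  by rewrite -card_gt0 cardsT V1.
(* Any two vertices form a clique or a stable set; a base of at least [2] lets the constant
   [c <= 2 ^ c] be absorbed into the exponent. *)
have m2 : 2 <= maxn #|A| #|B|.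
  have [x [y [_ _ nxy]]] : exists x y : V, [/\ x \in V, y \in V & x != y].
    by case/card_gt1P: V2 => x [y [h1 h2 h3]]; exists x, y.
  have cxy : #|[set x; y]| = 2 by rewrite cards2 nxy.
  have key (f : rel V) : symmetric f -> irreflexive f -> ~~ f x y -> 2 <= alpha f [set: V].
    move=> fsym firr nf; rewrite -cxy; apply: leq_alpha; first exact: subsetT.
    by apply/stabP => u w /set2P[]-> /set2P[]->; rewrite ?firr // fsym.
  rewrite leq_max cA cB; apply/orP; case: (boolP (e x y)) => exy; [right|left]; apply: key => //.
  - exact: compl_rel_sym.
  - exact: compl_rel_irr.
  by rewrite /compl_rel exy andbF.
apply: leq_trans hV _; rewrite -addnS expnD mulnC leq_mul2l; apply/orP; right.
apply: (@leq_trans (2 ^ c)); first exact: ltnW (ltn_expl c (isT : 1 < 2)).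
by apply: (@leq_trans (2 ^ c.+1)); [rewrite leq_pexp2l|rewrite leq_exp2r].
Qed.

(** * Passage to a real exponent *)

Import Order.TTheory GRing.Theory Num.Theory.

Lemma powR_inv_le (R : realType) (n m d : nat) : 0 < d -> n <= m ^ d ->
  ((n%:R : R) `^ (d%:R^-1) <= m%:R)%R.
Proof.
move=> d0 hn; apply: (@le_trans _ _ (((m ^ d)%:R : R) `^ (d%:R^-1))%R).
  by apply: ge0_ler_powR; rewrite ?nnegrE ?invr_ge0 ?ler0n ?ler_nat.
rewrite natrX -powR_mulrn ?ler0n // -powRrM divff ?powRr1 ?ler0n //.
by rewrite pnatr_eq0 -lt0n.
Qed.

Theorem theorem1p3 (R : realType) : erdos_hajnal R (vc_dim_le 2).
Proof.
have [d [d0 h]] := large_homogeneous_set.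
exists (d%:R^-1)%R; split; first by rewrite invr_gt0 ltr0n.
move=> G /vc_no_shatter3 hG.
have [A [hA cA]] := h G _ (@adj_sym G) (@adj_irrefl G) hG.
exists A; split; last exact: powR_inv_le.
case: hA => /stabP sA; [right|left] => x y xA yA nxy; first exact: sA.
by have := sA x y xA yA; rewrite /compl_rel nxy negbK.
Qed.
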